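(* Let $m\in\mathbb{N}$ and let $N(x)=\varepsilon_m\,x^{-1}$ for $x\in (S\oplus V)\setminus\{0\}$, where $\varepsilon_m=\dfrac{(-1)^m}{2^{2m+1}\,m!\,\pi^{m+1}}$. Then (i) $\Delta^mN(x)=E(x)$ for all $x\in(S\oplus V)\setminus\{0\}$; (ii) $N$ is (left) holomorphic Cliffordian on $(S\oplus V)\setminus\{0\}$, and $D\Delta^mN=\delta$ in the sense of distributions on $S\oplus V\cong\mathbb{R}^{2m+2}$, where $\delta$ is the Dirac measure at the origin.
   Context: $\mathbb{R}_{0,2m+1}$ is the Clifford algebra of a real vector space $V$ of dimension $2m+1$ with a negative definite quadratic form; $e_1,\dots,e_{2m+1}$ is an orthonormal basis of $V$ (so $e_i^2=-1$, $e_ie_j=-e_je_i$ for $i\ne j$, $i,j\geq 1$) and $e_0=1$. $S=\mathbb{R}$ is the space of scalars. A point $(x_0,\dots,x_{2m+1})\in\mathbb{R}^{2m+2}$ is identified with $x=\sum_{i=0}^{2m+1}e_ix_i\in S\oplus V\subset\mathbb{R}_{0,2m+1}$; $x^*=x_0-\sum_{i=1}^{2m+1}e_ix_i$, $xx^*=x^*x=|x|^2$, and $x^{-1}=x^*/|x|^2$ for $x\neq0$. $D=\sum_{i=0}^{2m+1}e_i\frac{\partial}{\partial x_i}$ (acting from the left) and $\Delta=\sum_{i=0}^{2m+1}\frac{\partial^2}{\partial x_i^2}$. A function $f:\Omega\to\mathbb{R}_{0,2m+1}$, $\Omega\subset S\oplus V$ open, is (left) holomorphic Cliffordian in $\Omega$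 if $D\Delta^mf=0$ on $\Omega$, where $\Delta^m$ is the $m$-times iterated Laplacian. $E$ is the Cauchy kernel of monogenic functions: $E(x)=\dfrac{1}{\omega_m}\dfrac{x^*}{|x|^{2m+2}}$ for $x\ne0$, with $\omega_m=\dfrac{2\pi^{m+1}}{\Gamma(m+1)}$ the area of the unit sphere in $\mathbb{R}^{2m+2}$. *)

(* Defs.v *)
From HB Require Import structures.
From mathcomp Require Import all_boot all_order all_algebra.
From mathcomp Require Import all_classical all_reals all_analysis.
Import Order.TTheory GRing.Theory Num.Theory.
Import numFieldNormedType.Exports.

Set Implicit Arguments.
Unset Strict Implicit.
Unset Printing Implicit Defensive.

Local Open Scope classical_set_scope.
Local Open Scope ring_scope.

Definition symdiff (T : finType) (A B : {set T}) : {set T} :=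
  (A :\: B) :|: (B :\: A).

(* The Clifford algebra of an n-dimensional negative definite space, on the   *)
(* basis e_A = e_{i1} ... e_{ik}, A = {i1 < ... < ik}; an element is the      *)
(* family of its coordinates.                                                 *)
Definition clifford (R : comNzRingType) (n : nat) : Type :=
  {ffun {set 'I_n} -> R^o}.

HB.instance Definition _ (R : comNzRingType) n :=
  GRing.Lmodule.copy (clifford R n) {ffun {set 'I_n} -> R^o}.

Section CliffordMul.
Variables (R : comNzRingType) (n : nat).
Implicit Types (A B C : {set 'I_n}) (a b c : clifford R n).

Definition coef A a : R := (a : {ffun {set 'I_n} -> R^o}) A.

Definition cbasis A : clifford R n := [ffun B => (B == A)%:R : R^o].

(* e_A e_B = csign A B *: e_(symdiff A B): every pair j < i with i in A and   *)
(* j in B is swapped once, and every common index i contributes e_i^2 = -1.   *)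
Definition csign A B : R :=
  \prod_(i in A) \prod_(j in B | (j <= i)%N) (-1).

Definition cmul a b : clifford R n :=
  \sum_A \sum_B (csign A B * coef A a * coef B b) *: cbasis (symdiff A B).

Lemma coef_is_linear A : linear (coef A : clifford R n -> R^o).
Proof. by move=> k a b; rewrite /coef !ffunE. Qed.
HB.instance Definition _ A :=
  GRing.isLinear.Build R (clifford R n) R^o _ (coef A) (coef_is_linear A).

Lemma cliffordP a b : (forall A, coef A a = coef A b) <-> a = b.
Proof. by split=> [eq_ab|->//]; apply/ffunP => A; exact: eq_ab. Qed.

Lemma coef_cbasis A B : coef A (cbasis B) = (A == B)%:R.
Proof. by rewrite /coef ffunE. Qed.

Lemma cbasisE a : a = \sum_A coef A a *: cbasis A.
Proof.
apply/cliffordP => B; rewrite linear_sum (bigD1 B)//= linearZ/= coef_cbasis.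
rewrite eqxx big1 ?addr0 => [|A AB]; first by rewrite /GRing.scale/= mulr1.
by rewrite linearZ/= coef_cbasis eq_sym (negbTE AB) /GRing.scale/= mulr0.
Qed.

Lemma symdiffA : associative (@symdiff 'I_n).
Proof.
by move=> A B C; apply/setP => i; rewrite !inE; do !case: (_ \in _).
Qed.

Lemma symdiff0 A : symdiff finset.set0 A = A.
Proof. by apply/setP => i; rewrite !inE; case: (_ \in _). Qed.

Lemma symdiffs0 A : symdiff A finset.set0 = A.
Proof. by apply/setP => i; rewrite !inE; case: (_ \in _). Qed.

Lemma prod_symdiff A B (x : 'I_n -> R) : (forall i, x i * x i = 1) ->
  \prod_(i in symdiff A B) x i = (\prod_(i in A) x i) * \prod_(i in B) x i.
Proof.
move=> xx; rewrite [X in X * _]big_mkcond [X in _ * X]big_mkcond -big_split/=.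
rewrite big_mkcond; apply: eq_bigr => i _; rewrite !inE.
by case: (i \in A); case: (i \in B); rewrite ?mulr1 ?mul1r ?xx.
Qed.

Lemma csign_symdiffl A B C : csign (symdiff A B) C = csign A C * csign B C.
Proof.
rewrite /csign prod_symdiff// => i.
by rewrite -big_split/= big1// => j _; rewrite mulrNN mulr1.
Qed.

Lemma csign_symdiffr A B C : csign A (symdiff B C) = csign A B * csign A C.
Proof.
rewrite /csign -big_split/=; apply: eq_bigr => i _; rewrite !big_mkcondr/=.
by apply: prod_symdiff => j; case: ifP => _; rewrite ?mulr1 ?mulrNN ?mulr1.
Qed.

Lemma csign0l B : csign finset.set0 B = 1.
Proof. by rewrite /csign big_pred0// => i; rewrite inE. Qed.

Lemma csignr0 A : csign A finset.set0 = 1.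
Proof. by rewrite /csign big1// => i _; rewrite big_pred0// => j; rewrite inE. Qed.

Lemma cmulDl : left_distributive cmul +%R.
Proof.
move=> a b c; rewrite /cmul -big_split/=; apply: eq_bigr => A _.
rewrite -big_split/=; apply: eq_bigr => B _.
by rewrite linearD/= mulrDr mulrDl scalerDl.
Qed.

Lemma cmulDr : right_distributive cmul +%R.
Proof.
move=> a b c; rewrite /cmul -big_split/=; apply: eq_bigr => A _.
rewrite -big_split/=; apply: eq_bigr => B _.
by rewrite linearD/= mulrDr scalerDl.
Qed.

Lemma cmulZl k a b : cmul (k *: a) b = k *: cmul a b.
Proof.
rewrite /cmul scaler_sumr; apply: eq_bigr => A _.
rewrite scaler_sumr; apply: eq_bigr => B _; rewrite scalerA linearZ/=.
by congr (_ *: _); rewrite /GRing.scale/= !mulrA [csign _ _ * k]mulrC.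
Qed.

Lemma cmulZr k a b : cmul a (k *: b) = k *: cmul a b.
Proof.
rewrite /cmul scaler_sumr; apply: eq_bigr => A _.
rewrite scaler_sumr; apply: eq_bigr => B _; rewrite scalerA linearZ/=.
by congr (_ *: _); rewrite /GRing.scale/= mulrCA.
Qed.

Lemma cmul0l a : cmul 0 a = 0.
Proof. by have := cmulZl 0 0 a; rewrite !scale0r. Qed.

Lemma cmul0r a : cmul a 0 = 0.
Proof. by have := cmulZr 0 a 0; rewrite !scale0r. Qed.

Lemma cmul_suml (I : finType) (F : I -> clifford R n) b :
  cmul (\sum_i F i) b = \sum_i cmul (F i) b.
Proof.
exact: (big_morph (cmul^~ b) (fun x y => cmulDl x y b) (cmul0l b)).
Qed.

Lemma cmul_sumr (I : finType) (F : I -> clifford R n) a :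
  cmul a (\sum_i F i) = \sum_i cmul a (F i).
Proof. exact: (big_morph (cmul a) (cmulDr a) (cmul0r a)). Qed.

Lemma cmul_basis A B :
  cmul (cbasis A) (cbasis B) = csign A B *: cbasis (symdiff A B).
Proof.
rewrite /cmul (bigD1 A)//= (bigD1 B)//= !coef_cbasis !eqxx !mulr1.
rewrite [X in _ + X + _]big1 ?addr0 => [|B' nB]; last first.
  by rewrite coef_cbasis (negbTE nB) mulr0 scale0r.
rewrite big1 ?addr0// => A' nA; rewrite big1// => B' _.
by rewrite coef_cbasis (negbTE nA) mulr0 mul0r scale0r.
Qed.

Lemma cmulA : associative cmul.
Proof.
have basisA A B C : cmul (cbasis A) (cmul (cbasis B) (cbasis C)) =
                    cmul (cmul (cbasis A) (cbasis B)) (cbasis C).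
  rewrite !cmul_basis cmulZr cmulZl !cmul_basis !scalerA symdiffA.
  by rewrite csign_symdiffl csign_symdiffr mulrC -mulrA.
move: cmul cmul_suml cmul_sumr cmulZl cmulZr basisA => f fsl fsr fZl fZr fA.
move=> a b c; rewrite (cbasisE a) !fsl; apply: eq_bigr => A _.
rewrite !fZl (cbasisE b) !(fsl, fsr); congr (_ *: _).
apply: eq_bigr => B _; rewrite !(fZl, fZr) (cbasisE c) !fsr; congr (_ *: _).
by apply: eq_bigr => C _; rewrite !fZr fA.
Qed.

Lemma cmul1l : left_id (cbasis finset.set0) cmul.
Proof.
move=> a; rewrite {1}(cbasisE a) cmul_sumr [RHS]cbasisE; apply: eq_bigr => A _.
by rewrite cmulZr cmul_basis csign0l scale1r symdiff0.
Qed.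

Lemma cmulr1 : right_id (cbasis finset.set0) cmul.
Proof.
move=> a; rewrite {1}(cbasisE a) cmul_suml [RHS]cbasisE; apply: eq_bigr => A _.
by rewrite cmulZl cmul_basis csignr0 scale1r symdiffs0.
Qed.

Lemma cone_neq0 : cbasis finset.set0 != 0.
Proof.
apply/eqP => /cliffordP/(_ finset.set0); rewrite coef_cbasis eqxx linear0.
by apply/eqP; exact: oner_neq0.
Qed.

HB.instance Definition _ := GRing.Zmodule_isNzRing.Build (clifford R n)
  cmulA cmul1l cmulr1 cmulDl cmulDr cone_neq0.

HB.instance Definition _ := GRing.Lmodule_isLalgebra.Build R (clifford R n)
  (fun k a b => esym (cmulZl k a b)).

HB.instance Definition _ := GRing.Lalgebra_isAlgebra.Build R (clifford R n)
  (fun k a b => esym (cmulZr k a b)).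

Definition gen (i : 'I_n) : clifford R n := cbasis [set i]%SET.

Lemma gen_sqr i : gen i * gen i = -1.
Proof.
rewrite [LHS]cmul_basis (_ : symdiff _ _ = finset.set0); last first.
  by apply/setP => j; rewrite !inE andNb.
rewrite /csign big_set1 (big_pred1 i) ?scaleN1r// => j.
by rewrite inE/=; case: (eqVneq j i) => [->|//]; rewrite leqnn.
Qed.

Lemma gen_anticomm i j : i != j -> gen i * gen j = - (gen j * gen i).
Proof.
have csign1 (k l : 'I_n) :
    csign [set k]%SET [set l]%SET = if (l <= k)%N then -1 else 1.
  by rewrite /csign big_set1 big_mkcondr big_set1.
move=> ij; rewrite [gen i * _]cmul_basis [gen j * _]cmul_basis.
rewrite (_ : symdiff [set j]%SET _ = symdiff [set i]%SET [set j]%SET); last first.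
  by rewrite /symdiff finset.setUC.
rewrite -scaleNr; congr (_ *: _); rewrite !csign1.
case: ltngtP => [_|_|/val_inj ji]; rewrite ?opprK//.
by rewrite ji eqxx in ij.
Qed.

Lemma cbasis_prod A : cbasis A = \prod_(i in A) gen i.
Proof.
have prod_sorted (s : seq 'I_n) : sorted ltn (map val s) ->
    \prod_(i <- s) gen i = cbasis [set i in s]%SET.
  elim: s => [_|i s IH].
    by rewrite big_nil; congr cbasis; apply/setP => j; rewrite !inE.
  rewrite /= path_sortedE => [/andP[/allP is_ ss]|]; last exact: ltn_trans.
  have lt_is j : j \in s -> (i < j)%N by move=> js; apply/is_/map_f.
  rewrite big_cons IH// [LHS]cmul_basis /csign big_set1 big_pred0 ?scale1r.
    congr cbasis; apply/setP => j; rewrite !inE.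
    have [->|_] := eqVneq j i; last by case: (_ \in _).
    by case: (boolP (i \in s)) => // /lt_is; rewrite ltnn.
  move=> j; rewrite inE; apply/negP => /andP[/lt_is].
  by rewrite ltnNge => /negbTE->.
rewrite -big_filter prod_sorted; last first.
  rewrite sorted_map sorted_filter//; first by move=> ? ? ?; exact: ltn_trans.
  rewrite [index_enum _]unlock -enumT -(@sorted_map _ _ val) val_enum_ord.
  exact: iota_ltn_sorted.
by congr cbasis; apply/setP => i; rewrite inE mem_filter mem_index_enum andbT.
Qed.

End CliffordMul.

Arguments coef {R n}.
Arguments gen {R n}.

Section MeasurableRV.
Variables (R : realType) (n : nat).

Definition rV_coord (i : 'I_n) (x : 'rV[R]_n) : R := x 0 i.

Let rV_set0 : g_sigma_preimage rV_coord set0.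
Proof. exact: sigma_algebra0. Qed.

Let rV_setC A : g_sigma_preimage rV_coord A -> g_sigma_preimage rV_coord (~` A).
Proof. exact: sigma_algebraC. Qed.

Let rV_bigcup (F : (set _)^nat) : (forall i, g_sigma_preimage rV_coord (F i)) ->
  g_sigma_preimage rV_coord (\bigcup_i (F i)).
Proof. exact: sigma_algebra_bigcup. Qed.

(* The product (Borel) sigma-algebra, generated by the coordinates. *)
HB.instance Definition _ := @isMeasurable.Build
  (measure_tuple_display default_measure_display) 'rV[R]_n
  (g_sigma_preimage rV_coord) rV_set0 rV_setC rV_bigcup.

Lemma measurable_rV_coord i : measurable_fun setT (rV_coord i).
Proof.
move=> _ Y mY; rewrite setTI; apply: sub_sigma_algebra => /=.
rewrite -bigcup_seq/=; exists i => /=; first by rewrite mem_index_enum.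
by exists Y => //; rewrite setTI.
Qed.

Lemma measurable_fun_rV d (T : measurableType d) (f : T -> 'rV[R]_n) :
  (forall i, measurable_fun setT (rV_coord i \o f)) -> measurable_fun setT f.
Proof.
move=> mf; pose P := [set A | measurable (f @^-1` A)].
suff sub : g_sigma_preimage rV_coord `<=` P.
  by move=> _ Y mY; rewrite setTI; exact: sub.
apply: smallest_sub.
- split => [|A PA|F PF]; rewrite /P/=.
  + by rewrite preimage_set0.
  + by rewrite setTD preimage_setC; exact: measurableC.
  + by rewrite preimage_bigcup; exact: bigcupT_measurable.
- rewrite -bigcup_seq; apply: bigcup_sub => i _ A [B mB <-].
  by rewrite /P/= setTI -[X in measurable X]setTI; exact: mf.
Qed.

End MeasurableRV.

Section LebesgueRV.
Variable R : realType.
Local Open Scope ereal_scope.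

Definition rV_cons n (p : measurableTypeR R * 'rV[R]_n) : 'rV[R]_n.+1 :=
  \row_i if unlift ord0 i is Some j then p.2 0%R j else p.1.

Definition rV_uncons n (x : 'rV[R]_n.+1) : (measurableTypeR R * 'rV[R]_n)%type :=
  (x 0%R ord0, \row_j x 0%R (lift ord0 j)).

Lemma rV_consK n : cancel (@rV_cons n) (@rV_uncons n).
Proof.
move=> [a x]; rewrite /rV_uncons /rV_cons mxE unlift_none; congr pair.
by apply/rowP => j; rewrite !mxE liftK.
Qed.

Lemma rV_unconsK n : cancel (@rV_uncons n) (@rV_cons n).
Proof.
by move=> x; apply/rowP => i; rewrite !mxE; case: unliftP => [j|] ->; rewrite ?mxE.
Qed.

Lemma measurable_rV_cons n : measurable_fun setT (@rV_cons n).
Proof.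
apply: measurable_fun_rV => i; case: (unliftP ord0 i) => [j|] ->.
  rewrite (_ : _ \o _ = rV_coord j \o snd); last first.
    by apply/funext => p; rewrite /rV_coord/= mxE liftK.
  by apply: measurableT_comp => //; exact: measurable_rV_coord.
rewrite (_ : _ \o _ = fst)//.
by apply/funext => p; rewrite /rV_coord/= mxE unlift_none.
Qed.

Lemma measurable_rV_uncons n : measurable_fun setT (@rV_uncons n).
Proof.
apply/measurable_fun_pairP; split.
  exact: (@measurable_rV_coord R n.+1 ord0).
apply: measurable_fun_rV => i.
rewrite (_ : _ \o _ = rV_coord (lift ord0 i)); first exact: measurable_rV_coord.
by apply/funext => x; rewrite /rV_coord/= mxE.
Qed.

Section Step.
Variables (n : nat) (nu : {sigma_finite_measure set 'rV[R]_n -> \bar R}).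

Definition lebesgue_rV_step : set 'rV[R]_n.+1 -> \bar R :=
  pushforward (@lebesgue_measure R \x nu) (@rV_cons n).

Let mcons := @measurable_rV_cons n.

Let step0 : lebesgue_rV_step set0 = 0.
Proof. exact: measure0. Qed.

Let step_ge0 A : 0 <= lebesgue_rV_step A.
Proof. exact: measure_ge0. Qed.

Let step_sigma_additive : semi_sigma_additive lebesgue_rV_step.
Proof.
exact: measure_semi_sigma_additive.
Qed.

HB.instance Definition _ := isMeasure.Build _ _ _ lebesgue_rV_step
  step0 step_ge0 step_sigma_additive.

Let step_sigma_finite : sigma_finite setT lebesgue_rV_step.
Proof.
have /sigma_finiteP[F [TF ndF Ffin]] := sigma_finiteT (@lebesgue_measure R).
have /sigma_finiteP[G [TG ndG Gfin]] := sigma_finiteT nu.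
exists (fun i => @rV_uncons n @^-1` (F i `*` G i)).
  rewrite -preimage_bigcup (_ : \bigcup_i _ = setT) ?preimage_setT//.
  rewrite -setXTT TF TG predeqE => -[x y]; split => [[i _ []]|/= [[k _ Fkx] [l _ Gly]]].
    by move=> ? ?; split; exists i.
  exists (maxn k l) => //; split.
  - by move: x Fkx; exact/subsetPset/ndF/leq_maxl.
  - by move: y Gly; exact/subsetPset/ndG/leq_maxr.
move=> i; have [[mF Fi] [mG Gi]] := (Ffin i, Gfin i); split.
  by rewrite -[X in measurable X]setTI; apply: measurable_rV_uncons => //; exact: measurableX.
rewrite /lebesgue_rV_step /pushforward -comp_preimage.
rewrite (_ : _ \o _ = id) ?preimage_id; last first.
  by apply/funext => p /=; rewrite rV_consK.
by rewrite product_measure1E// lte_mul_pinfty// ge0_fin_numE.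
Qed.

HB.instance Definition _ := @Measure_isSigmaFinite.Build _ _ _
  lebesgue_rV_step step_sigma_finite.

End Step.

(* n-dimensional Lebesgue measure, see lebesgue_rV_box. *)
Fixpoint lebesgue_rV n : {sigma_finite_measure set 'rV[R]_n -> \bar R} :=
  if n is n'.+1 then lebesgue_rV_step (lebesgue_rV n')
  else dirac (0%R : 'rV[R]_0).

Lemma lebesgue_rV_box n (A : 'I_n -> set (measurableTypeR R)) :
  (forall i, measurable (A i)) ->
  lebesgue_rV n [set x : 'rV[R]_n | forall i, A i (x 0%R i)] =
  \prod_(i < n) lebesgue_measure (A i).
Proof.
elim: n A => [|n IH] A mA.
  rewrite big_ord0 /= diracE mem_set//=.
  by move=> i; have := ltn_ord i; rewrite ltn0.
rewrite big_ord_recl -IH //= /lebesgue_rV_step /pushforward.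
rewrite -product_measure1E//.
  congr (_ _); apply/seteqP; split => -[a x] /=.
    move=> H; split; first by have := H ord0; rewrite mxE unlift_none.
    by move=> j; have := H (lift ord0 j); rewrite mxE liftK.
  by move=> [Aa Ax] i; rewrite mxE; case: unliftP => [j|] ->.
rewrite (_ : mkset _ = \bigcap_(i in setT) (rV_coord i @^-1` A (lift ord0 i))).
  apply: fin_bigcap_measurable => // i _; rewrite -[X in measurable X]setTI.
  by apply: (measurable_rV_coord i) => //; exact: mA.
by apply/seteqP; split => x H i //=; exact: H.
Qed.

End LebesgueRV.

Section Paravectors.
Variables (R : realType) (n : nat).
Implicit Types x : 'rV[R]_n.+1.

(* e_0 = 1 and e_1, ..., e_n are the generators. *)
Definition e (i : 'I_n.+1) : clifford R n :=
  if unlift ord0 i is Some j then gen j else 1.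

Definition paravector x : clifford R n := \sum_i x 0 i *: e i.

Definition pconj x : clifford R n :=
  x 0 ord0 *: 1 - \sum_(j < n) x 0 (lift ord0 j) *: gen j.

(* The Euclidean norm; the library norm `|x| of a row vector is the sup norm. *)
Definition enorm x : R := Num.sqrt (\sum_i x 0 i ^+ 2).

(* x^-1 = x^* / |x|^2, with the junk value 0 at the origin. *)
Definition pinv x : clifford R n := (enorm x ^+ 2)^-1 *: pconj x.

Let vec x : clifford R n := \sum_(j < n) x 0 (lift ord0 j) *: gen j.

Lemma vec_sqr x : vec x * vec x = - (\sum_(j < n) x 0 (lift ord0 j) ^+ 2)%:A.
Proof.
pose a j := x 0 (lift ord0 j).
have E1 : vec x * vec x = \sum_i \sum_j (a i * a j) *: (gen i * gen j).
  rewrite mulr_suml; apply: eq_bigr => i _; rewrite mulr_sumr.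
  by apply: eq_bigr => j _; rewrite -scalerAl -scalerAr scalerA.
have E2 : vec x * vec x = \sum_i \sum_j (a i * a j) *: (gen j * gen i).
  rewrite E1 exchange_big; apply: eq_bigr => i _; apply: eq_bigr => j _.
  by rewrite mulrC.
have two : vec x * vec x + vec x * vec x =
           - (\sum_i a i ^+ 2)%:A - (\sum_i a i ^+ 2)%:A.
  rewrite {1}E1 E2 -big_split/= scaler_suml -sumrN -big_split/=.
  apply: eq_bigr => i _; rewrite -big_split/= (bigD1 i)//= big1 ?addr0.
    by rewrite gen_sqr scalerN -expr2.
  move=> j ji; rewrite -scalerDr gen_anticomm 1?eq_sym//.
  by rewrite addNr scaler0.
have two0 : (2 : R) != 0 by rewrite pnatr_eq0.
by apply: (scalerI two0); rewrite !scaler_nat [LHS]mulr2n [RHS]mulr2n.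
Qed.

Lemma enorm_sqr x :
  enorm x ^+ 2 = x 0 ord0 ^+ 2 + \sum_(j < n) x 0 (lift ord0 j) ^+ 2.
Proof.
rewrite sqr_sqrtr; last by apply: sumr_ge0 => i _; rewrite sqr_ge0.
by rewrite big_ord_recl.
Qed.

Lemma paravectorE x : paravector x = x 0 ord0 *: 1 + vec x.
Proof.
rewrite /paravector big_ord_recl /e unlift_none; congr (_ + _).
by apply: eq_bigr => j _; rewrite liftK.
Qed.

Lemma paravector_pconj x : paravector x * pconj x = (enorm x ^+ 2)%:A.
Proof.
rewrite paravectorE /pconj -/(vec x) mulrDl !mulrBr vec_sqr opprK enorm_sqr.
rewrite scalerDl -!scalerAl -!scalerAr !mul1r mulr1 scalerA expr2.
by rewrite addrA subrK.
Qed.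

Lemma pconj_paravector x : pconj x * paravector x = (enorm x ^+ 2)%:A.
Proof.
rewrite paravectorE /pconj -/(vec x) mulrBl !mulrDr vec_sqr enorm_sqr.
rewrite scalerDl -!scalerAl -!scalerAr !mul1r mulr1 scalerA expr2.
by rewrite opprD opprK addrA addrK.
Qed.

Lemma paravector_pinv x : x != 0 -> paravector x * pinv x = 1.
Proof.
move=> x0; rewrite -scalerAr paravector_pconj scalerA mulVf ?scale1r//.
apply: contra x0; rewrite sqrf_eq0 sqrtr_eq0 => x_le0.
have /eqP := le_anti (introT andP (conj x_le0
  (sumr_ge0 _ (fun i _ => sqr_ge0 (x 0 i))))).
rewrite psumr_eq0 => [/allP x0|i _]; last exact: sqr_ge0.
apply/eqP/rowP => i; rewrite mxE; apply/eqP.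
by have := x0 i (mem_index_enum i); rewrite sqrf_eq0.
Qed.

End Paravectors.

Definition partial (R : realType) n (i : 'I_n) (g : 'rV[R]_n -> R)
  (x : 'rV[R]_n) : R := 'D_(delta_mx 0 i) g x.

(* g is of class C^k on the open set Omega *)
Fixpoint class_C (R : realType) n (k : nat) (Omega : set 'rV[R]_n)
    (g : 'rV[R]_n -> R) : Prop :=
  (forall x, Omega x -> {for x, continuous g}) /\
  if k is k'.+1 then
    forall i : 'I_n, (forall x, Omega x -> derivable g x (delta_mx 0 i)) /\
                     class_C k' Omega (partial i g)
  else True.

Section CliffordAnalysis.
Variables (R : realType) (n : nat).
Implicit Types (f : 'rV[R]_n.+1 -> clifford R n) (i : 'I_n.+1).

Definition cpartial i f (x : 'rV[R]_n.+1) : clifford R n :=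
  [ffun A : {set 'I_n} => partial i (fun y => coef A (f y)) x : R^o].

Definition cauchyD f (x : 'rV[R]_n.+1) : clifford R n :=
  \sum_i e R i * cpartial i f x.

Definition laplacian f (x : 'rV[R]_n.+1) : clifford R n :=
  \sum_i cpartial i (cpartial i f) x.

End CliffordAnalysis.

(* D Delta^m has order 2m+1, so that f is understood to be of class C^(2m+1). *)
Definition holomorphic_cliffordian (R : realType) (m : nat)
    (Omega : set 'rV[R]_m.*2.+2) (f : 'rV[R]_m.*2.+2 -> clifford R m.*2.+1) :=
  [/\ open Omega,
      forall A, class_C m.*2.+1 Omega (fun x => coef A (f x)) &
      forall x, Omega x -> cauchyD (iter m (@laplacian R m.*2.+1) f) x = 0].

Definition test_function (R : realType) n (phi : 'rV[R]_n -> R) : Prop :=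
  (forall k, class_C k setT phi) /\ compact (closure [set x | phi x != 0]).

Section Distributions.
Variables (R : realType) (n : nat).

(* Distributions as functionals, acting by duality; only the values on   *)
(* real test functions are meaningful, see eq_dist.                           *)
Definition cdist : Type := ('rV[R]_n.+1 -> R) -> clifford R n.

Implicit Types (T : cdist) (phi : 'rV[R]_n.+1 -> R).

Definition eq_dist T1 T2 : Prop :=
  forall phi, test_function phi -> T1 phi = T2 phi.

Definition locally_integrable_cliff (f : 'rV[R]_n.+1 -> clifford R n) : Prop :=
  forall (A : {set 'I_n}) (K : set 'rV[R]_n.+1), compact K ->
    (lebesgue_rV R n.+1).-integrable K (fun x => (coef A (f x))%:E).

Definition regular_dist (f : 'rV[R]_n.+1 -> clifford R n) : cdist := fun phi =>
  [ffun A : {set 'I_n} =>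
    \int[lebesgue_rV R n.+1]_x (phi x * coef A (f x)) : R^o].

Definition measure_dist (mu : {measure set 'rV[R]_n.+1 -> \bar R}) : cdist :=
  fun phi => (\int[mu]_x phi x)%:A.

Definition dist_partial (i : 'I_n.+1) T : cdist :=
  fun phi => - T (partial i phi).

Definition dist_cauchyD T : cdist :=
  fun phi => \sum_i e R i * dist_partial i T phi.

Definition dist_laplacian T : cdist :=
  fun phi => \sum_i dist_partial i (dist_partial i T) phi.

End Distributions.

Definition Gamma (R : realType) (s : R) : R :=
  \int[lebesgue_measure]_(t in `]0, +oo[) (t `^ (s - 1) * expR (- t)).

Definition omega (R : realType) (m : nat) : R :=
  2 * pi ^+ m.+1 / Gamma m.+1%:R.

Definition epsilon (R : realType) (m : nat) : R :=
  (-1) ^+ m / (2 ^+ m.*2.+1 * m`!%:R * pi ^+ m.+1).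

Definition cauchy_kernel (R : realType) (m : nat) (x : 'rV[R]_m.*2.+2) :
    clifford R m.*2.+1 :=
  (omega R m)^-1 *: ((enorm x ^+ m.*2.+2)^-1 *: pconj x).

Definition N_kernel (R : realType) (m : nat) (x : 'rV[R]_m.*2.+2) :
    clifford R m.*2.+1 :=
  epsilon R m *: pinv x.

(* Main.v *)
Require Import Defs.
From mathcomp Require Import all_boot all_order all_algebra.
From mathcomp Require Import all_classical all_reals all_analysis.
From mathcomp Require Import measurable_realfun ring lra.
Import Order.TTheory GRing.Theory Num.Theory.
Import numFieldNormedType.Exports.
Local Open Scope classical_set_scope.
Local Open Scope ring_scope.

Set Implicit Arguments.
Unset Strict Implicit.
Unset Printing Implicit Defensive.

Local Arguments lebesgue_rV : simpl never.

(* Neither polar coordinates nor the divergence theorem is needed.  Put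
   d = 2m + 2 and q = |x|^2.  On the basis e_A, the kernels x^* q^-k have
   coordinates l(x) q^-k with l linear, and the Laplacian maps l q^-k to
   -4 k (m + 1 - k) l q^-(k+1) away from 0; this gives (i) and, since
   D (x^* q^-k) = (d - 2k) q^-k, the holomorphy of N.

   For the distributional equation, one integrates by parts along the lines
   parallel to an axis.  Almost all of them avoid the origin, so the only
   requirement is that both kernels be O(|x|^-(d-1)), which is locally
   integrable because |x|^-(d-1) <= prod_i |x_i|^-(1-1/d).  This moves the 2m
   derivatives of Delta^m from the test function phi to N and turns N into E.

   The last derivative would produce a kernel of order -d.  Hence E is replaced
   by E h_k, where h_k = 1 - exp(-k q) sum_(j <= m) (k q)^j / j!.  The matrix of
   the derivatives d_i (x_l q^-(m+1) h_k) is symmetric, so that only its trace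
   contributes to the Clifford product, and this trace is the Gaussian
   2 k^(m+1) exp(-k q) / m!, of integral 2 pi^(m+1) / m! = omega_m.  Letting k
   tend to infinity, dominated convergence on one side and concentration of the
   Gaussian at 0 on the other give phi(0). *)

(** * Measurability of open sets and continuous functions on row vectors *)

Section MeasurabilityRV.
Context {R : realType} {n : nat}.

(** The sigma-algebra is generated by the coordinates, whereas open sets refer to the sup norm. The
    two meet in the boxes [B p] with rational centres and radii [1 / (p.2 + 1)]: an open set is the
    union of those it contains, and they are countably many. *)
Lemma open_measurable_rV (U : set 'rV[R]_n) : open U -> measurable U.
Proof.
move=> oU; pose B (p : 'rV[rat]_n * nat) : set 'rV[R]_n :=
  [set x | forall i, `|x 0 i - ratr (p.1 0 i)| < p.2.+1%:R^-1].
have mB p : measurable (B p).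
  rewrite (_ : B p = \bigcap_(i in setT)
      (@rV_coord R n i @^-1` ball (ratr (p.1 0 i) : R) p.2.+1%:R^-1)).
    apply: fin_bigcap_measurable => // i _; rewrite -[X in measurable X]setTI.
    by apply: (measurable_rV_coord i) => //; exact: measurable_ball.
  apply/seteqP; split => x H i => [_|]; last first.
    by have := H i I; rewrite /ball/= distrC.
  by rewrite /ball/= distrC; exact: H.
rewrite (_ : U = \bigcup_p (if `[< B p `<=` U >] then B p else set0)).
  apply: countable_bigcupT_measurable; first exact: countableP.
  by move=> p; case: ifP.
apply/seteqP; split => [x Ux|x [p _]]; last by case: ifPn => // /asboolP; exact.
have /nbhs_ballP[e /= e0 eU] : nbhs x U by apply: open_nbhs_nbhs.
(* A radius below [e / 2] keeps the whole box within distance [e] of [x], although its centre is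
   only close to [x]. *)
have [k] : exists k, 0 + k.+1%:R^-1 < e / 2 by apply: ltr_add_invr; lra.
rewrite add0r => ke.
have k0 : 0 < k.+1%:R^-1 :> R by rewrite invr_gt0.
have /choice[q xq] i : exists q : rat, `|x 0 i - ratr q| < k.+1%:R^-1.
  have [|q] := @rat_in_itvoo R (x 0 i - k.+1%:R^-1) (x 0 i + k.+1%:R^-1).
    by rewrite ltrBlDr -addrA ltrDl addr_gt0.
  by rewrite in_itv/= => qx; exists q; rewrite ltr_distlC.
exists (\row_i q i, k) => //; case: asboolP => [_ i|]; first by rewrite mxE.
apply: contra_notP => _ y By; apply: eU; split => // i j; rewrite (ord1 i).
have := By j; rewrite mxE => /= yq; have := xq j.
rewrite /ball/= => xqj.
rewrite (_ : _ - _ = (x 0 j - ratr (q j)) - (y 0 j - ratr (q j))); last by ring.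
by apply: le_lt_trans (ler_normB _ _) _; rewrite (splitr e) ltrD// (lt_trans _ ke).
Qed.

Lemma open_neq0 : open [set x : 'rV[R]_n | x != 0].
Proof.
rewrite (_ : mkset _ = ~` [set 0]); last first.
  by apply/seteqP; split => x /= /eqP.
apply/closed_openC/accessible_closed_set1.
exact/hausdorff_accessible/norm_hausdorff.
Qed.

(** The preimage of an open interval is open up to the single point 0, whatever value [f] takes
    there. This covers the singular kernels. *)
Lemma measurable_continuous_off0 (f : 'rV[R]_n -> R) :
  (forall x, x != 0 -> {for x, continuous f}) -> measurable_fun setT f.
Proof.
move=> cf; apply: (measurability _ (RGenOpens.measurableE R)) => _ [_ [a [b ->] <-]].
rewrite setTI; set I := (X in f @^-1` X).
have m0 : measurable [set 0 : 'rV[R]_n].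
  rewrite -[X in measurable X]setCK; apply: measurableC.
  rewrite (_ : ~` _ = [set x | x != 0]); last first.
    by apply/seteqP; split => x /= /eqP.
  by apply: open_measurable_rV; exact: open_neq0.
have mI : measurable (f @^-1` I `\` [set 0]).
  apply: open_measurable_rV; rewrite openE => x [/= fx /eqP x0].
  have n0 : nbhs x [set x : 'rV[R]_n | x != 0].
    by apply: open_nbhs_nbhs; split => //; exact: open_neq0.
  have nf : nbhs x (f @^-1` I).
    apply: (cf x x0); apply: open_nbhs_nbhs; split => //; exact: interval_open.
  by apply: filterS2 nf n0 => y fy /eqP y0; split.
have [f0|f0] := pselect (I (f 0)).
  rewrite (_ : f @^-1` I = (f @^-1` I `\` [set 0]) `|` [set 0]).
    exact: measurableU.
  apply/seteqP; split => [x fx|x [[]|->]]//=.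
  by have [->|/eqP] := eqVneq x 0; [right|left].
rewrite (_ : f @^-1` I = (f @^-1` I `\` [set 0])) //.
by apply/seteqP; split => [x fx|x []//]; split => // x0; apply: f0; rewrite -x0.
Qed.

Lemma continuous_measurable_rV (f : 'rV[R]_n -> R) :
  continuous f -> measurable_fun setT f.
Proof. by move=> cf; apply: measurable_continuous_off0 => x _; exact: cf. Qed.

Lemma compact_measurable_rV (K : set 'rV[R]_n) : compact K -> measurable K.
Proof.
move=> cK; rewrite -[X in measurable X]setCK; apply: measurableC.
have cl : closed K by apply: compact_closed cK; exact: norm_hausdorff.
by apply: open_measurable_rV; exact: closed_openC.
Qed.

End MeasurabilityRV.

(** * Fubini and Tonelli with the first coordinate split off *)

Section IntegralRV.
Context {R : realType}.
Local Notation leb := (@lebesgue_rV R).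
Local Notation mu := (@lebesgue_measure R).
Local Open Scope ereal_scope.

(** By definition [lebesgue_rV n.+1] is the image of a product measure under [rV_cons], so this is
    Tonelli's theorem after a change of variables. *)
Lemma ge0_integral_rVS n (f : 'rV[R]_n.+1 -> \bar R) :
  measurable_fun setT f -> (forall x, 0 <= f x) ->
  \int[leb n.+1]_x f x = \int[mu]_t \int[leb n]_y f (rV_cons (t, y)).
Proof.
move=> mf f0.
transitivity (\int[pushforward (mu \x leb n) (@rV_cons R n)]_x f x) => //.
rewrite (ge0_integral_pushforward (@measurable_rV_cons R n))//.
rewrite preimage_setT (fubini_tonelli1 (f \o @rV_cons R n))//.
  by apply: measurableT_comp => //; exact: measurable_rV_cons.
by move=> x; exact: f0.
Qed.

Lemma integrable_rVS n (f : 'rV[R]_n.+1 -> \bar R) :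
  (leb n.+1).-integrable setT f ->
  (mu \x leb n).-integrable setT (f \o @rV_cons R n).
Proof.
move=> /integrableP[mf fi]; apply/integrableP; split.
  by apply: measurableT_comp => //; exact: measurable_rV_cons.
apply: le_lt_trans fi.
rewrite le_eqVlt; apply/orP; left; apply/eqP; symmetry.
transitivity (\int[pushforward (mu \x leb n) (@rV_cons R n)]_x `|f x|) => //.
rewrite (ge0_integral_pushforward (@measurable_rV_cons R n))//.
by apply: measurableT_comp.
Qed.

Lemma integral_rVS n (f : 'rV[R]_n.+1 -> \bar R) :
  (leb n.+1).-integrable setT f ->
  \int[leb n.+1]_x f x = \int[mu]_t \int[leb n]_y f (rV_cons (t, y)).
Proof.
move=> fi.
transitivity (\int[pushforward (mu \x leb n) (@rV_cons R n)]_x f x) => //.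
rewrite (integral_pushforward (@measurable_rV_cons R n))//; last 2 first.
- exact: measurable_int fi.
- by rewrite preimage_setT; exact: integrable_rVS.
by rewrite preimage_setT -integral12_prod_meas1//; exact: integrable_rVS.
Qed.

Lemma ge0_integral_prod_rV n (w : R -> R) :
  measurable_fun setT w -> (forall t, 0 <= w t)%R ->
  \int[leb n]_x (\prod_(i < n) w (x ord0 i))%:E =
  \prod_(i < n) \int[mu]_t (w t)%:E.
Proof.
move=> mw w0; elim: n => [|n IH].
  under eq_integral do rewrite big_ord0.
  rewrite big_ord0 integral_dirac//.
  by rewrite diracT mul1e.
have mp k : measurable_fun setT (fun x : 'rV[R]_k => (\prod_(i < k) w (x ord0 i))%:E).
  apply/measurable_EFinP; apply: measurable_prod => i _.
  by apply: measurableT_comp => //; exact: measurable_rV_coord.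
have p0 k (x : 'rV[R]_k) : 0 <= (\prod_(i < k) w (x ord0 i))%:E.
  by rewrite lee_fin prodr_ge0.
rewrite ge0_integral_rVS//.
have inner t : \int[leb n]_y (\prod_(i < n.+1) w (rV_cons (t, y) ord0 i))%:E =
    (w t)%:E * \prod_(i < n) \int[mu]_t (w t)%:E.
  rewrite -IH -ge0_integralZl//; [|exact: mp|by rewrite lee_fin].
  apply: eq_integral => y _; rewrite -EFinM big_ord_recl mxE unlift_none.
  by congr (_ * _)%:E; apply: eq_bigr => i _; rewrite mxE liftK.
under eq_integral do rewrite inner.
rewrite big_ord_recl ge0_integralZr//.
- exact/measurable_EFinP.
- by move=> t _; rewrite lee_fin.
- by apply: prode_ge0 => i _; apply: integral_ge0 => t _; rewrite lee_fin.
Qed.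

End IntegralRV.

(** * Powers [|t|^(b - 1)] on the line, integrable near 0 for [b > 0] *)

Section RealLine.
Context {R : realType}.
Implicit Types (f F : R -> R) (a b c L t : R).
Local Notation mu := (@lebesgue_measure R).

Lemma is_derive1_continuous F t (dF : R) :
  is_derive t (1 : R) F dF -> {for t, continuous F}.
Proof. by move=> [dFt _]; exact/differentiable_continuous/derivable1_diffP. Qed.

Lemma integral_is_derive f F a b : a < b ->
  (forall t, a <= t <= b -> is_derive t (1 : R) F (f t)) ->
  (forall t, a <= t <= b -> {for t, continuous f}) ->
  (\int[mu]_(t in `[a, b]) (f t)%:E = (F b - F a)%:E)%E.
Proof.
move=> ab dF cf; rewrite EFinB; apply: continuous_FTC2 => //.
- apply: continuous_in_subspaceT => t; rewrite inE/= in_itv/=; exact: cf.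
- split.
  + move=> t; rewrite in_itv/= => /andP[at_ tb].
    by have [|] := dF t; rewrite ?(ltW at_) ?(ltW tb).
  + apply: cvg_at_right_filter; apply: (@is_derive1_continuous _ _ (f a)).
    by apply: dF; rewrite lexx ltW.
  + apply: cvg_at_left_filter; apply: (@is_derive1_continuous _ _ (f b)).
    by apply: dF; rewrite lexx ltW.
- move=> t; rewrite in_itv/= => /andP[at_ tb]; rewrite derive1E.
  by have [|] := dF t; rewrite ?(ltW at_) ?(ltW tb).
Qed.

(** The bound does not depend on [c], which later tends to 0. *)
Lemma integral_powR_ge0 c L b : 0 < c -> c < L -> 0 < b ->
  (\int[mu]_(t in `[c, L]) (t `^ (b - 1))%:E <= (L `^ b / b)%:E)%E.
Proof.
move=> c0 cL b0.
have ct0 t : c <= t <= L -> 0 < t by move=> /andP[ct _]; exact: lt_le_trans ct.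
have dF t : c <= t <= L -> is_derive t (1 : R) (fun t => t `^ b / b) (t `^ (b - 1)).
  move=> /ct0 t0.
  refine (is_derive_eq (is_deriveM (is_derive1_powR b t0)
    (is_derive_cst (b^-1) t (1 : R))) _); rewrite scaler0 add0r /GRing.scale/= mulrA mulVf ?mul1r//.
  by rewrite gt_eqF.
rewrite (integral_is_derive cL dF).
  by rewrite lee_fin gerBl divr_ge0 ?powR_ge0 ?ltW.
by move=> t /ct0 t0; exact: is_derive1_continuous (is_derive1_powR _ t0).
Qed.

Lemma integral_powR_le0 c L b : 0 < c -> c < L -> 0 < b ->
  (\int[mu]_(t in `[(- L)%R, (- c)%R]) ((- t) `^ (b - 1))%:E <= (L `^ b / b)%:E)%E.
Proof.
move=> c0 cL b0; have cL' : - L < - c by rewrite ltrN2.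
have ct0 t : - L <= t <= - c -> 0 < - t.
  by move=> /andP[_ tc]; rewrite (lt_le_trans c0)// lerNr.
have dp (p t : R) : 0 < - t ->
    is_derive t (1:R) ((fun s => s `^ p) \o -%R) (p * (- t) `^ (p - 1) * (- 1)).
  by move=> t0; exact: is_derive1_comp (is_derive1_powR p t0) _.
have dF t : - L <= t <= - c ->
    is_derive t (1 : R) (fun t => - ((- t) `^ b / b)) ((- t) `^ (b - 1)).
  move=> /ct0 t0.
  refine (is_derive_eq (is_deriveN (is_deriveM (dp b _ t0)
    (is_derive_cst (b^-1) t (1 : R)))) _); rewrite scaler0 add0r /GRing.scale/=.
  by rewrite mulrN1 mulrN opprK mulrA mulVf ?mul1r// gt_eqF.
rewrite (integral_is_derive cL' dF).
  by rewrite !opprK lee_fin gerDr oppr_le0 divr_ge0 ?powR_ge0 ?ltW.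
by move=> t /ct0 t0; exact: is_derive1_continuous (dp (b - 1) _ t0).
Qed.

(** With [b = 1 / d], this is the one-variable factor of the majorant of [|x|^-(d - 1)]. *)
Definition trunc_powR L b t : R := if `|t| <= L then `|t| `^ (b - 1) else 0.

Lemma trunc_powR_ge0 L b t : 0 <= trunc_powR L b t.
Proof. by rewrite /trunc_powR; case: ifP => // _; exact: powR_ge0. Qed.

Lemma measurable_trunc_powR L b : measurable_fun setT (trunc_powR L b).
Proof.
apply: measurable_fun_if => //.
- by apply: measurable_fun_ler => //; exact: normr_measurable.
- apply: measurable_funTS.
  apply: (measurableT_comp (f := fun s => s `^ (b - 1)) (@measurable_powR R _)).
  exact: normr_measurable.
Qed.

(** The sets [F k] exhaust the support while staying away from 0. On each of them the integral is at
    most [2 L^b / b], and monotone convergence carries this bound to the limit. *)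
Lemma integral_trunc_powR_lty L b : 0 < L -> 0 < b -> b != 1 ->
  (\int[mu]_t (trunc_powR L b t)%:E < +oo)%E.
Proof.
(* The denominator [k.+2] makes [c k] strictly smaller than [L] already for [k = 0]. *)
move=> L0 b0 b1; pose c k : R := L / k.+2%:R.
have c0 k : 0 < c k by rewrite divr_gt0.
have cL k : c k < L by rewrite ltr_pdivrMr// ltr_pMr// ltr1n.
pose F k : set R := [set` `[- L, - c k]] `|` [set` `[c k, L]].
have mw := measurable_trunc_powR L b.
have mF k : measurable (F k) by exact: measurableU.
(* Since [b != 1], the power of 0 takes the default value 0, so the support omits 0 and is exactly
   the union of the [F k]. *)
have FT : \bigcup_k F k = [set t | trunc_powR L b t != 0].
  apply/seteqP; split => [t [k _]|t].
    have ck := c0 k; have cl := cL k; rewrite /F/= !in_itv/= /trunc_powR.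
    by case=> /andP[t1 t2]; rewrite ifT ?powR_eq0 ?normr_eq0;
       rewrite ?ler_norml ?negb_and; lra.
  rewrite /= /trunc_powR; case: ifPn; last by rewrite eqxx.
  move=> tL; rewrite powR_eq0 normr_eq0 negb_and subr_eq0 b1 orbF => t0.
  have [k ck] : exists k, 0 + k.+1%:R^-1 < `|t| / L.
    by apply: ltr_add_invr; rewrite divr_gt0// normr_gt0.
  rewrite add0r ltr_pdivlMr// in ck.
  have ckt : c k <= `|t|.
    apply: le_trans (ltW ck); rewrite /c [leRHS]mulrC ler_wpM2l ?(ltW L0)//.
    by rewrite lef_pV2 ?posrE// ler_nat.
  exists k => //; rewrite /F/= !in_itv/=.
  by move: ckt tL; case: (ger0P t) => ? ? ?; [right|left]; apply/andP; split; lra.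
have -> : (\int[mu]_t (trunc_powR L b t)%:E =
    \int[mu]_(t in \bigcup_k F k) (trunc_powR L b t)%:E)%E.
  rewrite [RHS]integral_mkcond; apply: eq_integral => t _; rewrite patchE FT.
  by case: ifPn => //; rewrite notin_setE/= => /negP; rewrite negbK => /eqP->.
apply: (@le_lt_trans _ _ (L `^ b / b + L `^ b / b)%:E); last by rewrite ltry.
have ndF : nondecreasing_seq F.
  move=> k l kl; apply/subsetPset => t; rewrite /F/= !in_itv/=.
  have : c l <= c k by rewrite /c ler_wpM2l ?(ltW L0)// lef_pV2 ?posrE// ler_nat.
  by move=> ?; case=> /andP[? ?]; [left|right]; apply/andP; split; lra.
have cvF : (\int[mu]_(t in F k) (trunc_powR L b t)%:E @[k --> \oo] -->
    \int[mu]_(t in \bigcup_k F k) (trunc_powR L b t)%:E)%E.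
  apply: ge0_nondecreasing_set_cvg_integral => //.
  - by move=> ?; refine (measurable_funTS _); exact/measurable_EFinP.
  - by move=> k t _; rewrite lee_fin trunc_powR_ge0.
rewrite -(cvg_lim _ cvF)//; apply: lime_le.
  by apply/cvg_ex; eexists; exact: cvF.
apply: nearW => k; have ck := c0 k; have cl := cL k.
rewrite ge0_integral_setU//=; last 3 first.
- by refine (measurable_funTS _); exact/measurable_EFinP.
- by move=> t _; rewrite lee_fin trunc_powR_ge0.
- by apply/disj_setPS => t [/=]; rewrite !in_itv/=; lra.
rewrite EFinD; apply: leeD.
  apply: le_trans (integral_powR_le0 ck cl b0).
  rewrite le_eqVlt; apply/orP; left; apply/eqP; apply: eq_integral => t.
  rewrite inE/= in_itv/= /trunc_powR => /andP[t1 t2].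
  by rewrite ler0_norm ?ifT//; lra.
apply: le_trans (integral_powR_ge0 ck cl b0).
rewrite le_eqVlt; apply/orP; left; apply/eqP; apply: eq_integral => t.
rewrite inE/= in_itv/= /trunc_powR => /andP[t1 t2].
by rewrite ger0_norm ?ifT//; lra.
Qed.

End RealLine.

(** * Integration along the lines parallel to an axis *)

Section LinesRV.
Context {R : realType}.
Local Notation leb := (@lebesgue_rV R).
Local Notation mu := (@lebesgue_measure R).

Definition rV_update n (x : 'rV[R]_n) (i : 'I_n) (t : R) : 'rV[R]_n :=
  \row_k if k == i then t else x 0 k.

(** A coordinate hyperplane is a box with one side [[set 0]]; the zero factor makes the product of
    the side lengths 0 even though the other factors are infinite. *)
Lemma ae_rV_neq0 n : {ae leb n, forall x : 'rV[R]_n, forall k, x 0%R k != 0%R}.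
Proof.
apply: filter_forall => k.
pose A i : set (measurableTypeR R) := if i == k then [set 0] else setT.
have mA i : measurable (A i) by rewrite /A; case: ifP.
exists [set x : 'rV[R]_n | forall i, A i (x 0 i)]; split.
- rewrite (_ : mkset _ = \bigcap_(i in setT) (@rV_coord R n i @^-1` A i)).
    apply: fin_bigcap_measurable => // i _; rewrite -[X in measurable X]setTI.
    by apply: (measurable_rV_coord i) => //; exact: mA.
  by apply/seteqP; split => x H i //=; exact: H.
- rewrite lebesgue_rV_box// (bigD1 k)//= {1}/A eqxx.
  by rewrite [X in (X * _)%E]lebesgue_measure_set1 mul0e.
- move=> x /= /negP; rewrite negbK => /eqP xk i.
  by rewrite /A; case: eqP => [->|].
Qed.

Lemma integral_rVS_swap n (f : 'rV[R]_n.+1 -> \bar R) :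
  (leb n.+1).-integrable setT f ->
  (\int[leb n.+1]_x f x = \int[leb n]_y \int[mu]_t f (rV_cons (t, y)))%E.
Proof.
move=> fi; have fi' := integrable_rVS fi.
rewrite (integral_rVS fi).
have := integral12_prod_meas1 fi'; rewrite -(integral21_prod_meas1 fi').
exact.
Qed.

(** Induction on the dimension, splitting off the first coordinate. If [i] is a later direction, the
    induction hypothesis applies to almost every slice; if [i] is the first one, the order of
    integration is exchanged so that the line integral becomes the inner one. Lines on which another
    coordinate vanishes form a null set. *)
Lemma integral_lines_eq0 n (i : 'I_n) (g : 'rV[R]_n -> R) :
  (leb n).-integrable setT (EFin \o g) ->
  (forall x : 'rV[R]_n, (forall k, k != i -> x 0%R k != 0%R) ->
    \int[mu]_t (g (rV_update x i t))%:E = 0)%E ->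
  (\int[leb n]_x (g x)%:E = 0)%E.
Proof.
elim: n i g => [[]//|n IH] i g gi g0.
have gi' := integrable_rVS gi.
case: (unliftP ord0 i) => [j ij|i0].
  rewrite (integral_rVS gi) -[RHS](@integral0 _ _ _ mu setT).
  apply: ae_eq_integral => //; first exact: (measurable_fubini_F gi').
  have t0 : {ae mu, forall t : R, t != 0}.
    exists [set 0]; split => //; first exact: lebesgue_measure_set1.
    by move=> t /= /negP; rewrite negbK => /eqP.
  apply: filterS2 (ae_integrable1 gi') t0 => t gti tn0 _.
  apply: (IH j (fun y => g (rV_cons (t, y)))) => // y y0.
  rewrite -[RHS](g0 (rV_cons (t, y))); last first.
    move=> k; case: (unliftP ord0 k) => [l ->|-> _]; last by rewrite mxE unlift_none.
    by rewrite ij mxE liftK (inj_eq lift_inj); exact: y0.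
  apply: eq_integral => s _; congr (g _)%:E; apply/rowP => k; rewrite !mxE.
  case: (unliftP ord0 k) => [l ->|->]; last by rewrite ij eq_liftF.
  by rewrite ij (inj_eq lift_inj) !mxE /=.
rewrite (integral_rVS_swap gi) -[RHS](@integral0 _ _ _ (leb n) setT).
apply: ae_eq_integral => //; first exact: (measurable_fubini_G gi').
apply: filterS (ae_rV_neq0 n) => y y0 _ /=.
(* The first coordinate 0 is a placeholder, overwritten by [rV_update]. *)
rewrite -[RHS](g0 (rV_cons (0, y))); last first.
  move=> k; case: (unliftP ord0 k) => [l -> _|->]; last by rewrite i0 eqxx.
  by rewrite mxE liftK; exact: y0.
apply: eq_integral => s _; congr (g _)%:E; apply/rowP => k; rewrite i0 !mxE.
case: (unliftP ord0 k) => [l ->|->]; last by rewrite eqxx.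
by rewrite lift_eqF.
Qed.

End LinesRV.

(** * Comparison of the Euclidean norm with the coordinates *)

Section EuclideanNorm.
Context {R : realType} {n : nat}.
Implicit Types x : 'rV[R]_n.+1.

Lemma enorm_ge0 x : 0 <= enorm x.
Proof. exact: sqrtr_ge0. Qed.

Lemma enorm_sum_sqr x : enorm x ^+ 2 = \sum_i x 0 i ^+ 2.
Proof. by rewrite sqr_sqrtr// sumr_ge0// => i _; exact: sqr_ge0. Qed.

Lemma ler_coord_enorm x i : `|x 0 i| <= enorm x.
Proof.
rewrite -(@ler_pXn2r _ 2) ?nnegrE ?enorm_ge0// enorm_sum_sqr real_normK ?num_real//.
by rewrite (bigD1 i)//= lerDl sumr_ge0// => j _; exact: sqr_ge0.
Qed.

Lemma enorm_gt0 x : (0 < enorm x) = (x != 0).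
Proof.
rewrite lt_neqAle enorm_ge0 andbT; congr (~~ _).
apply/eqP/eqP => [x0|->].
  apply/rowP => i; rewrite mxE; apply/eqP; rewrite -normr_le0 x0.
  exact: ler_coord_enorm.
apply/esym/eqP; rewrite -sqrf_eq0 enorm_sum_sqr big1// => i _.
by rewrite mxE expr0n.
Qed.

End EuclideanNorm.

(** * An integrable product majorant of [|x|^-n] in dimension [n + 1] *)

Section Majorant.
Context {R : realType} {n : nat}.
Local Notation leb := (@lebesgue_rV R).
Local Notation mu := (@lebesgue_measure R).

(** With [d = n + 1], [|x|^-n] is a product of [d] factors [|x|^(1/d - 1)]. The exponent is not
    positive, so no factor decreases when [|x|] is replaced by the smaller [|x_i|]. *)
Lemma prod_trunc_powR_ge L (x : 'rV[R]_n.+1) :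
  (forall i, x 0 i != 0) -> (forall i, `|x 0 i| <= L) ->
  enorm x ^- n <= \prod_i trunc_powR L (n.+1%:R^-1) (x 0 i).
Proof.
move=> x0 xL; have r0 : 0 < enorm x.
  by rewrite enorm_gt0; apply: contra (x0 ord0) => /eqP ->; rewrite mxE.
have b1 : 0 <= 1 - n.+1%:R^-1 :> R by rewrite subr_ge0 invf_le1// ler1n.
have -> : enorm x ^- n = \prod_(i < n.+1) enorm x `^ (n.+1%:R^-1 - 1).
  rewrite prodr_const card_ord -[RHS]powR_mulrn ?powR_ge0// -powRrM.
  by rewrite mulrBl mulVf ?mul1r// -natr1 opprD addrCA subrr addr0 powR_invn// ltW.
apply: ler_prod => i _; rewrite powR_ge0/= /trunc_powR xL.
rewrite -(opprB 1) !powRN lef_pV2 ?posrE ?powR_gt0 ?normr_gt0//.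
by apply: ge0_ler_powR; rewrite ?nnegrE ?enorm_ge0// ler_coord_enorm.
Qed.

(** Off the coordinate hyperplanes [|f|] is at most [C] times the product majorant, whose integral
    is the power [n + 1] of a finite integral over the line. *)
Lemma integrable_enorm (f : 'rV[R]_n.+1 -> R) C L : (0 < n)%N -> 0 <= C -> 0 < L ->
  measurable_fun setT f ->
  (forall x, x != 0 -> `|f x| <= C * enorm x ^- n) ->
  (forall x, f x != 0 -> forall i, `|x 0 i| <= L) ->
  (leb n.+1).-integrable setT (EFin \o f).
Proof.
move=> n0 C0 L0 mf fC fL; apply/integrableP; split; first exact/measurable_EFinP.
pose w := trunc_powR L (n.+1%:R^-1).
have mw : measurable_fun setT w by exact: measurable_trunc_powR.
have w0 t : 0 <= w t by exact: trunc_powR_ge0.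
have mW : measurable_fun setT (fun x : 'rV[R]_n.+1 => (\prod_i w (x 0 i))%:E).
  apply/measurable_EFinP; apply: measurable_prod => i _.
  by apply: measurableT_comp => //; exact: measurable_rV_coord.
apply: (@le_lt_trans _ _
    (\int[leb n.+1]_x (C%:E * (\prod_(i < n.+1) w (x ord0 i))%:E)))%E.
  apply: ae_ge0_le_integral => //.
  - by apply: measurableT_comp => //; exact/measurable_EFinP.
  - by move=> x _; rewrite -EFinM lee_fin mulr_ge0// prodr_ge0.
  - by apply: measurable_funeM.
  apply: filterS (ae_rV_neq0 n.+1) => x x0 _ /=.
  rewrite -EFinM lee_fin; have [->|fx] := eqVneq (f x) 0.
    by rewrite normr0 mulr_ge0// prodr_ge0.
  apply: le_trans (fC x _) _.
    by apply: contra (x0 ord0) => /eqP ->; rewrite mxE.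
  by rewrite ler_wpM2l//; apply: prod_trunc_powR_ge => //; exact: fL.
rewrite ge0_integralZl//; last by move=> x _; rewrite lee_fin prodr_ge0.
rewrite ge0_integral_prod_rV//.
have : (\int[mu]_t (w t)%:E < +oo)%E.
  apply: integral_trunc_powR_lty => //.
  (* The exponent parameter [1 / (n + 1)] differs from 1 because [0 < n]. *)
  by rewrite neq_lt invf_lt1// ltr1n ltnS n0.
have : (0 <= \int[mu]_t (w t)%:E)%E by apply: integral_ge0 => t _; rewrite lee_fin.
case: (integral _ _ _) => // c _ _.
by rewrite prodEFin -EFinM ltry.
Qed.

End Majorant.

(** * Supports, bounds and derivatives of test functions *)

Section TestFunctions.
Context {R : realType} {n : nat}.
Implicit Types (phi : 'rV[R]_n.+1 -> R) (i : 'I_n.+1) (x : 'rV[R]_n.+1).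

Lemma test_function_continuous phi : test_function phi -> continuous phi.
Proof. by move=> [/(_ 0)[cphi _] _] x; exact: cphi. Qed.

Lemma test_function_is_derive phi i x : test_function phi ->
  is_derive x (delta_mx 0 i) phi (partial i phi x).
Proof. by move=> [/(_ 1)[_ /(_ i)[dphi _]] _]; apply/derivableP/dphi. Qed.

Lemma partial_eq0 phi i x : (~ closure [set y | phi y != 0] x) ->
  partial i phi x = 0.
Proof.
move=> nx; rewrite /partial (@near_eq_derive _ _ _ _ (cst 0)) ?derive_cst//.
have : nbhs x (~` closure [set y | phi y != 0]).
  by apply: open_nbhs_nbhs; split => //; exact/closed_openC/closed_closure.
apply: filterS => y ny; apply/eqP; apply: contra_notT ny => py.
exact: subset_closure.
Qed.

(** By [partial_eq0] the derivative vanishes off the support of [phi], so its own support is a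
    closed subset of a compact set. *)
Lemma test_function_partial phi i : test_function phi ->
  test_function (partial i phi).
Proof.
move=> [cphi kphi]; split => [k|]; first by have [_ /(_ i)[_]] := cphi k.+1.
apply: subclosed_compact kphi _; first exact: closed_closure.
rewrite closureE; apply: smallest_sub; first exact: closed_closure.
by move=> x /=; apply: contra_neqP => nx; exact: partial_eq0.
Qed.

Lemma compact_coord_bounded (K : set 'rV[R]_n.+1) : compact K ->
  exists2 L : R, 0 < L & forall x, K x -> forall i, `|x 0 i| <= L.
Proof.
move=> /compact_bounded[M [Mr HM]].
exists (`|M| + 1); first by rewrite ltr_wpDl.
move=> x Kx i; have : `|x| <= `|M| + 1.
  by apply: HM => //; rewrite (le_lt_trans (ler_norm _))// ltrDl.
apply: le_trans; rewrite [leRHS]mx_normrE.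
exact: (@le_bigmax _ _ _ _ (fun ij => `|x ij.1 ij.2|) (0, i)).
Qed.

Lemma test_function_supp phi : test_function phi ->
  exists2 L : R, 0 < L & forall x, phi x != 0 -> forall i, `|x 0 i| <= L.
Proof.
move=> [_ /compact_coord_bounded[L L0 KL]]; exists L => // x phix.
by apply: KL; exact: subset_closure.
Qed.

Lemma test_function_bounded phi : test_function phi ->
  exists2 M : R, 0 <= M & forall x, `|phi x| <= M.
Proof.
move=> tphi; have [_ kphi] := tphi.
have : compact (phi @` closure [set x | phi x != 0]).
  apply: continuous_compact => //; apply: continuous_subspaceT.
  exact: test_function_continuous.
move=> /compact_bounded[M [Mr HM]].
exists (`|M| + 1); first by rewrite addr_ge0.
move=> x; have [->|phix] := eqVneq (phi x) 0; first by rewrite normr0 addr_ge0.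
apply: HM; first by rewrite (le_lt_trans (ler_norm _))// ltrDl.
by exists x => //; exact: subset_closure.
Qed.

End TestFunctions.

(** * Kernels with a locally integrable singularity at the origin *)

Section SingularKernels.
Context {R : realType} {n : nat}.
Local Notation leb := (@lebesgue_rV R n.+1).
Local Notation mu := (@lebesgue_measure R).
Implicit Types (f g phi : 'rV[R]_n.+1 -> R) (i : 'I_n.+1) (x : 'rV[R]_n.+1).

(** The order [n] is the dimension minus one. The bound is asked on boxes only, so that kernels of
    smaller order, which may decay more slowly at infinity, are included. *)
Definition singular_kernel f : Prop :=
  (forall x, x != 0 -> {for x, continuous f}) /\
  forall L : R, exists2 C : R, 0 <= C &
    forall x, x != 0 -> (forall k, `|x 0 k| <= L) -> `|f x| <= C * enorm x ^- n.

Lemma measurable_singular_kernel f : singular_kernel f -> measurable_fun setT f.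
Proof. by move=> [cf _]; exact: measurable_continuous_off0. Qed.

Lemma integrable_test_singular phi f : (0 < n)%N -> test_function phi ->
  singular_kernel f -> leb.-integrable setT (EFin \o (fun x => phi x * f x)).
Proof.
move=> n0 tphi sf.
have [L L0 phiL] := test_function_supp tphi.
have [M M0 phiM] := test_function_bounded tphi.
have [cf /(_ L)[C C0 fC]] := sf.
apply: (@integrable_enorm _ _ _ (M * C) L) => //.
- exact: mulr_ge0.
- apply: measurable_funM; last exact: measurable_singular_kernel.
  by apply: continuous_measurable_rV; exact: test_function_continuous.
- move=> x x0; have [->|phix] := eqVneq (phi x) 0.
    by rewrite mul0r normr0 !mulr_ge0// invr_ge0 exprn_ge0// enorm_ge0.
  by rewrite normrM -mulrA ler_pM//; apply: fC => //; exact: phiL.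
- by move=> x; rewrite mulf_eq0 negb_or => /andP[/phiL].
Qed.

Lemma Rintegral_sum (I : finType) (f : I -> 'rV[R]_n.+1 -> R) :
  (forall j, leb.-integrable setT (EFin \o f j)) ->
  \int[leb]_x (\sum_j f j x) = \sum_j \int[leb]_x f j x.
Proof.
move=> fi; rewrite /Rintegral.
under eq_integral do rewrite -sumEFin.
rewrite integral_sum// -sum_fine// => j _.
exact: (integrable_fin_num measurableT (fi j)).
Qed.

Lemma rV_updateE x i t :
  rV_update x i t = t *: delta_mx 0 i + rV_update x i 0 :> 'rV[R]_n.+1.
Proof.
apply/rowP => k; rewrite !mxE eqxx/=.
by case: eqP => _; rewrite ?mulr1 ?mulr0 ?addr0 ?add0r.
Qed.

Lemma continuous_rV_update x i : continuous (rV_update x i).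
Proof.
move=> t; rewrite (_ : rV_update x i =
    (fun t => t *: delta_mx 0 i + rV_update x i 0)); last first.
  by apply/funext => s; exact: rV_updateE.
by apply: cvgD; [exact: scalel_continuous|exact: cvg_cst].
Qed.

Lemma is_derive_rV_update f x i t df :
  is_derive (rV_update x i t) (delta_mx 0 i) f df ->
  is_derive t (1 : R) (fun s => f (rV_update x i s)) df.
Proof.
have E : (fun h => h^-1 *: (f (rV_update x i (h *: (1 : R) + t)) - f (rV_update x i t)))
    = (fun h => h^-1 *: (f (h *: delta_mx 0 i + rV_update x i t) - f (rV_update x i t))).
  apply/funext => h; congr (_ *: (f _ - _)).
  by rewrite rV_updateE [in RHS]rV_updateE scalerDl addrA /GRing.scale/= mulr1.
case=> [dft fE]; split.
  by move: dft; rewrite /derivable /= /comp /= E.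
by rewrite -fE /derive /= /comp /= E.
Qed.

End SingularKernels.

(** * Integration by parts against a singular kernel *)

Section IntegrationByParts.
Context {R : realType} {n : nat}.
Local Notation leb := (@lebesgue_rV R n.+1).
Local Notation mu := (@lebesgue_measure R).
Implicit Types (f g phi : 'rV[R]_n.+1 -> R) (i : 'I_n.+1) (x : 'rV[R]_n.+1).

Lemma integral_derive_eq0 (h dh : R -> R) L : 0 < L ->
  (forall t, is_derive t (1 : R) h (dh t)) -> continuous dh ->
  (forall t, L <= `|t| -> h t = 0) -> (forall t, L <= `|t| -> dh t = 0) ->
  (\int[mu]_t (dh t)%:E = 0)%E.
Proof.
move=> L0 dH cdh hL dhL.
have -> : (\int[mu]_t (dh t)%:E = \int[mu]_(t in `[(- L)%R, L]) (dh t)%:E)%E.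
  rewrite [RHS]integral_mkcond; apply: eq_integral => t _; rewrite patchE.
  case: ifPn => //; rewrite notin_setE/= in_itv/= -ler_norml => /negP.
  by rewrite -ltNge => /ltW/dhL ->.
have LL : - L < L by rewrite gtrN.
rewrite (integral_is_derive LL (fun t _ => dH t)) => [|t _]; last exact: cdh.
by rewrite !hL ?subrr// ?normrN ger0_norm// ltW.
Qed.

(* The line through [x] in the direction [i] misses the origin as soon as
   another coordinate of [x] is nonzero, so the singularity is never met. *)
Lemma integration_by_parts_singular phi f g i : (0 < n)%N -> test_function phi ->
  singular_kernel f -> singular_kernel g ->
  (forall x, x != 0 -> is_derive x (delta_mx 0 i) f (g x)) ->
  \int[leb]_x (partial i phi x * f x) = - \int[leb]_x (phi x * g x).
Proof.
move=> n0 tphi sf sg dfg.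
have tdphi := test_function_partial i tphi.
have i1 := integrable_test_singular n0 tdphi sf.
have i2 := integrable_test_singular n0 tphi sg.
apply/eqP; rewrite -addr_eq0 -RintegralD//; apply/eqP; rewrite /Rintegral.
(* The integrand is the derivative of [phi * f] in the direction [i]; it suffices that its integral
   over almost every line vanishes. *)
rewrite (integral_lines_eq0 (i := i)) //.
  exact: (integrableD _ i1 i2).
move=> x x0.
have upd0 t : rV_update x i t != 0.
  (* A second direction exists because [0 < n]. *)
  have [k ki] : exists k, k != i.
    have [->|i0] := eqVneq i ord0; last by exists ord0; rewrite eq_sym.
    by exists ord_max; rewrite -val_eqE/= -lt0n.
  apply: contra (x0 k ki) => /eqP/rowP/(_ k); rewrite !mxE (negbTE ki) => ->.
  by [].
have [L1 L10 phiL] := test_function_supp tphi.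
have [L2 L20 dphiL] := test_function_supp tdphi.
(* [L] exceeds both support bounds strictly, so that [phi] and its derivative already vanish at
   [|t| = L]. *)
pose L := L1 + L2 + 1.
have L0 : 0 < L by rewrite !addr_gt0.
have far (psi : 'rV[R]_n.+1 -> R) K t : K < L ->
    (forall x, psi x != 0 -> forall i, `|x 0 i| <= K) ->
    L <= `|t| -> psi (rV_update x i t) = 0.
  move=> KL psiK tL; apply/eqP; apply: contraTT tL => /psiK/(_ i).
  by rewrite mxE eqxx -ltNge => tK; exact: le_lt_trans KL.
apply: (@integral_derive_eq0
    (fun t => phi (rV_update x i t) * f (rV_update x i t)) _ L) => //.
- move=> t; apply: (@is_derive_rV_update _ _ (fun y => phi y * f y)).
  have d1 := test_function_is_derive i (rV_update x i t) tphi.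
  refine (is_derive_eq (is_deriveM d1 (dfg _ (upd0 t))) _).
  by rewrite addrC /GRing.scale/= [f _ * _]mulrC.
- move=> t; apply: (@continuous_comp _ _ _ (rV_update x i)
      (fun y => partial i phi y * f y + phi y * g y)).
    exact: continuous_rV_update.
  have cphi := test_function_continuous tphi.
  have cdphi := test_function_continuous tdphi.
  refine (continuousD (continuousM (cdphi _) (proj1 sf _ (upd0 t)))
                      (continuousM (cphi _) (proj1 sg _ (upd0 t)))).
- by move=> t tL; rewrite (far phi L1) ?mul0r// /L; lra.
- move=> t tL; rewrite (far phi L1) ?(far (partial i phi) L2) ?mul0r ?addr0 ?mul0r// /L; lra.
Qed.

End IntegrationByParts.

(** * Derivatives and growth of linear forms and of powers of [q = |x|^2] *)

Section Kernels.
Context {R : realType} {n : nat}.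
Implicit Types (f g : 'rV[R]_n.+1 -> R) (i : 'I_n.+1) (x v : 'rV[R]_n.+1).
Implicit Types (a : 'I_n.+1 -> R).

Definition sqnorm x : R := enorm x ^+ 2.

Definition linform a x : R := \sum_l a l * x 0 l.

Lemma sqnorm_gt0 x : x != 0 -> 0 < sqnorm x.
Proof. by rewrite -enorm_gt0 => x0; rewrite exprn_gt0. Qed.

Lemma sqnorm_neq0 x : x != 0 -> sqnorm x != 0.
Proof. by move=> /sqnorm_gt0/lt0r_neq0. Qed.

Lemma is_derive_coord x i l :
  is_derive x (delta_mx 0 i) (fun y : 'rV[R]_n.+1 => y 0 l) (l == i)%:R.
Proof.
have E : (fun h : R => h^-1 *: ((h *: delta_mx 0 i + x) 0 l - x 0 l)) @ 0^'
    --> ((l == i)%:R : R).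
  apply: cvg_near_cst.
  near=> h; rewrite !mxE eqxx addrK /GRing.scale/= mulKf//.
  by near: h; exact: nbhs_dnbhs_neq.
split; first by apply/cvg_ex; eexists; exact: E.
exact: cvg_lim E.
Unshelve. all: by end_near. Qed.

(** This reduces a directional derivative to a derivative on the real line, where the one-variable
    chain rule is available. *)
Lemma is_derive_line x v f df :
  is_derive x v f df <-> is_derive (0 : R) (1 : R) (fun s => f (s *: v + x)) df.
Proof.
have E : (fun h : R => h^-1 *: (f ((h *: (1 : R) + 0) *: v + x) - f ((0 : R) *: v + x)))
    = (fun h => h^-1 *: (f (h *: v + x) - f x)).
  by apply/funext => h; rewrite scale0r add0r addr0 /GRing.scale/= mulr1.
split=> -[d1 d2]; split.
- by move: d1; rewrite /derivable /= /comp /= E.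
- by move: d2; rewrite /derive /= /comp /= E.
- by move: d1; rewrite /derivable /= /comp /= E.
- by move: d2; rewrite /derive /= /comp /= E.
Qed.

Lemma is_derive_comp1 x v f (h : R -> R) df dh :
  is_derive x v f df -> is_derive (f x) (1 : R) h dh ->
  is_derive x v (fun y => h (f y)) (dh * df).
Proof.
move=> /is_derive_line dF dH; apply/is_derive_line.
apply: (@is_derive1_comp _ h (fun s => f (s *: v + x))) => //.
by rewrite scale0r add0r.
Qed.

Lemma is_derive_linform a x i : is_derive x (delta_mx 0 i) (linform a) (a i).
Proof.
have -> : linform a = \sum_l (fun y : 'rV[R]_n.+1 => a l * y 0 l).
  by apply/funext => y; rewrite fct_sumE.
have -> : a i = \sum_l a l * (l == i)%:R.
  by rewrite (bigD1 i)//= eqxx mulr1 big1 ?addr0// => l /negbTE ->; rewrite mulr0.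
apply: is_derive_sum => l.
refine (is_deriveZ (a l) (is_derive_coord x i l)).
Qed.

Lemma is_derive_sqnorm x i : is_derive x (delta_mx 0 i) sqnorm (2 * x 0 i).
Proof.
have -> : sqnorm = \sum_l (fun y : 'rV[R]_n.+1 => y 0 l ^+ 2).
  by apply/funext => y; rewrite fct_sumE /sqnorm enorm_sum_sqr.
have -> : 2 * x 0 i = \sum_l 2 * x 0 l * (l == i)%:R.
  by rewrite (bigD1 i)//= eqxx mulr1 big1 ?addr0// => l /negbTE ->; rewrite mulr0.
apply: is_derive_sum => l.
refine (is_derive_eq (is_deriveX 2 (is_derive_coord x i l)) _).
by rewrite /GRing.scale/= -mulr_natl expr1.
Qed.

Lemma is_derive_sqnormV x i k : x != 0 ->
  is_derive x (delta_mx 0 i) (fun y => sqnorm y ^- k)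
    (- (2 * k%:R * x 0 i * sqnorm x ^- k.+1)).
Proof.
move=> x0; have q0 := sqnorm_neq0 x0.
have dq := is_derive_sqnorm x i.
have dqk : is_derive x (delta_mx 0 i) (fun y => sqnorm y ^+ k)
    (k%:R * sqnorm x ^+ k.-1 * (2 * x 0 i)).
  apply: (is_derive_comp1 (h := fun t => t ^+ k) dq).
  split; first exact: exprn_derivable.
  by rewrite exp_derive /GRing.scale/= mulr1.
have qk0 : sqnorm x ^+ k != 0 by rewrite expf_eq0 (negbTE q0) andbF.
split; first by apply: (@derivableV _ _ (fun y => sqnorm y ^+ k)) => //; case: dqk.
rewrite (@deriveV _ _ (fun y => sqnorm y ^+ k) _ _ qk0); last by case: dqk.
case: dqk => _ ->; rewrite /GRing.scale/=.
(* The exponent [k.-1] is truncated at [k = 0], where both sides vanish. *)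
case: k qk0 => [|k] qk0 /=; first by rewrite mulr0n !(mul0r, mulr0, oppr0).
rewrite !exprS; field.
by rewrite q0 expf_eq0 (negbTE q0) andbF.
Qed.

Lemma continuous_linform a : continuous (linform a).
Proof.
move=> x; rewrite (_ : linform a = \sum_l (fun y : 'rV[R]_n.+1 => a l * y 0 l)); last first.
  by apply/funext => y; rewrite fct_sumE.
apply: (big_ind (fun f : 'rV[R]_n.+1 -> R => {for x, continuous f})) => [|f g cf cg|l _].
- exact: cst_continuous.
- exact: continuousD.
- apply: continuousM; [exact: cst_continuous|exact: coord_continuous].
Qed.

Lemma continuous_sqnorm : continuous sqnorm.
Proof.
move=> x; rewrite (_ : sqnorm = \sum_l (fun y : 'rV[R]_n.+1 => y 0 l * y 0 l)).
  apply: (big_ind (fun f : 'rV[R]_n.+1 -> R => {for x, continuous f})) => [|f g cf cg|l _].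
  - exact: cst_continuous.
  - exact: continuousD.
  - by apply: continuousM; exact: coord_continuous.
by apply/funext => y; rewrite fct_sumE /sqnorm enorm_sum_sqr; apply: eq_bigr => l _; rewrite expr2.
Qed.

Lemma continuous_sqnormV k x : x != 0 -> {for x, continuous (fun y => sqnorm y ^- k)}.
Proof.
move=> x0; apply: (@continuousV _ _ (fun y => sqnorm y ^+ k)).
  by rewrite expf_eq0 (negbTE (sqnorm_neq0 x0)) andbF.
apply: (@continuous_comp _ _ _ sqnorm (fun t => t ^+ k)); first exact: continuous_sqnorm.
exact: exprn_continuous.
Qed.

Lemma ler_linform a x : `|linform a x| <= (\sum_l `|a l|) * enorm x.
Proof.
rewrite mulr_suml; apply: le_trans (ler_norm_sum _ _ _) _.
by apply: ler_sum => l _; rewrite normrM ler_wpM2l// ler_coord_enorm.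
Qed.

Lemma ler_enorm_box (L : R) x : (forall k, `|x 0 k| <= L) -> enorm x <= n.+1%:R * L.
Proof.
move=> xL; have L0 : 0 <= L := le_trans (normr_ge0 _) (xL ord0).
rewrite -(@ler_pXn2r _ 2) ?nnegrE ?enorm_ge0 ?mulr_ge0// enorm_sum_sqr.
apply: (@le_trans _ _ (\sum_(i < n.+1) L ^+ 2)).
  by apply: ler_sum => i _; rewrite -real_normK ?num_real// ler_pXn2r ?nnegrE.
rewrite sumr_const card_ord -[leLHS]mulr_natl exprMn ler_wpM2r ?sqr_ge0//.
by rewrite expr2 ler_peMl// ler1n.
Qed.

(** On the box [|x| <= (n + 1) L], hence [|x|^-p = |x|^(n - p) |x|^-n] is at most a constant times
    [|x|^-n]. *)
Lemma singular_kernel_bound f (c : R) p : (p <= n)%N -> 0 <= c ->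
  (forall x, x != 0 -> {for x, continuous f}) ->
  (forall x, x != 0 -> `|f x| <= c * enorm x ^- p) -> singular_kernel f.
Proof.
move=> pn c0 cf fc; split=> // L.
(* The absolute value keeps the constant nonnegative when [L] is negative. *)
exists (c * `|n.+1%:R * L| ^+ (n - p)); first by rewrite mulr_ge0 ?exprn_ge0.
move=> x x0 xL; apply: le_trans (fc x x0) _; have r0 := x0; rewrite -enorm_gt0 in r0.
have -> : enorm x ^+ n = enorm x ^+ (n - p) * enorm x ^+ p by rewrite -exprD subnK.
rewrite -mulrA ler_wpM2l// invfM mulrA ler_peMl//.
  by rewrite invr_ge0 exprn_ge0// ltW.
rewrite ler_pdivlMr ?exprn_gt0// mul1r lerXn2r ?nnegrE ?enorm_ge0//.
exact: le_trans (ler_enorm_box xL) (ler_norm _).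
Qed.

End Kernels.

(** * The scalar kernels [l(x) q^-k] with [l] linear *)

Section LinearKernels.
Context {R : realType} {n : nat}.
Implicit Types (a : 'I_n.+1 -> R) (i : 'I_n.+1) (x : 'rV[R]_n.+1) (k : nat).

Definition ker a k x : R := linform a x * sqnorm x ^- k.

Definition dker a k i x : R :=
  a i * sqnorm x ^- k - 2 * k%:R * x 0 i * linform a x * sqnorm x ^- k.+1.

Definition ddker a k i x : R :=
  - (2 * k%:R * (2 * a i * x 0 i + linform a x) * sqnorm x ^- k.+1)
  + 4 * k%:R * k.+1%:R * x 0 i ^+ 2 * linform a x * sqnorm x ^- k.+2.

Lemma is_derive_ker a k i x : x != 0 ->
  is_derive x (delta_mx 0 i) (ker a k) (dker a k i x).
Proof.
move=> x0; refine (is_derive_eq (is_deriveM (is_derive_linform a x i)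
  (is_derive_sqnormV i k x0)) _).
by rewrite /dker /GRing.scale/=; ring.
Qed.

Lemma is_derive_dker a k i x : x != 0 ->
  is_derive x (delta_mx 0 i) (dker a k i) (ddker a k i x).
Proof.
move=> x0.
have d1 := is_deriveZ (a i) (is_derive_sqnormV i k x0).
have d2 := is_deriveM (is_derive_coord x i i) (is_derive_linform a x i).
have d3 := is_deriveZ (2 * k%:R) (is_deriveM d2 (is_derive_sqnormV i k.+1 x0)).
have := is_deriveB d1 d3.
rewrite (_ : _ - _ = dker a k i); last first.
  apply/funext => y; by rewrite /dker !fctE/= /GRing.scale/= !mulrA.
by move=> d; apply: (is_derive_eq d); rewrite /ddker !fctE /GRing.scale/= eqxx mulr1n; ring.
Qed.

(** Since the sum of [a_i x_i] is [l] and that of [x_i^2] is [q], with [d = n + 1] the two parts of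
    [ddker] sum to [-2k (d + 2) l q^-(k+1)] and [4k (k + 1) l q^-(k+1)]. *)
Lemma sum_ddker a k x : x != 0 -> \sum_i ddker a k i x =
  - (2 * k%:R * (n.+1%:R - 2 * k%:R)) * ker a k.+1 x.
Proof.
move=> x0; have q0 := sqnorm_neq0 x0.
rewrite big_split/= sumrN -mulr_suml -mulr_sumr big_split/=.
rewrite sumr_const card_ord -mulr_natr.
under eq_bigr do rewrite -mulrA.
rewrite -mulr_sumr -/(linform a x).
rewrite -2!mulr_suml -mulr_sumr -enorm_sum_sqr -/(sqnorm x) /ker.
rewrite [sqnorm x ^+ k.+2]exprS invfM -[linform a x *+ _]mulr_natr.
by move: (sqnorm x ^- k.+1) => u; field.
Qed.

Lemma continuous_ker a k x : x != 0 -> {for x, continuous (ker a k)}.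
Proof.
move=> x0; apply: continuousM; first exact: continuous_linform.
exact: continuous_sqnormV.
Qed.

Lemma continuous_dker a k i x : x != 0 -> {for x, continuous (dker a k i)}.
Proof.
move=> x0; apply: continuousB; apply: continuousM.
- exact: cst_continuous.
- exact: continuous_sqnormV.
- apply: continuousM; last exact: continuous_linform.
  apply: continuousM; [exact: cst_continuous|exact: coord_continuous].
- exact: continuous_sqnormV.
Qed.

Lemma continuous_ddker a k i x : x != 0 -> {for x, continuous (ddker a k i)}.
Proof.
have cc := @coord_continuous R 1 n.+1 0 i; have cl := @continuous_linform R n a.
move=> x0; apply: continuousD.
  apply: continuousN; apply: continuousM; last exact: continuous_sqnormV.
  apply: continuousM; first exact: cst_continuous.
  apply: continuousD; last exact: cl.
  apply: continuousM; [exact: cst_continuous|exact: cc].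
apply: continuousM; last exact: continuous_sqnormV.
apply: continuousM; last exact: cl.
apply: continuousM; first exact: cst_continuous.
apply: (@continuous_comp _ _ _ (fun y : 'rV[R]_n.+1 => y 0 i) (fun t => t ^+ 2)).
  exact: cc.
exact: exprn_continuous.
Qed.

Lemma enorm_sqnormV x k : sqnorm x ^- k = enorm x ^- k.*2.
Proof. by rewrite /sqnorm -exprM mul2n. Qed.

Lemma enormV_double x k :
  enorm x ^- k.+1.*2 = (enorm x)^-1 * (enorm x)^-1 * enorm x ^- k.*2.
Proof. by rewrite doubleS !exprS !invfM mulrA. Qed.

Lemma enormV_doubleS x k :
  enorm x ^- k.*2.+1 = (enorm x)^-1 * enorm x ^- k.*2.
Proof. by rewrite exprS invfM. Qed.

Let asum a := \sum_l `|a l|.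

Let asum_ge0 a : 0 <= asum a.
Proof. exact: sumr_ge0. Qed.

Let le_asum a i : `|a i| <= asum a.
Proof. by rewrite /asum (bigD1 i)//= lerDl sumr_ge0. Qed.

(** The kernel is homogeneous of degree [-(2k + 1)]. Each derivative lowers the degree by one,
    whence the stronger conditions on [k] for [dker] and [ddker]. *)
Lemma singular_kernel_ker a k : (k.*2.+1 <= n)%N -> singular_kernel (ker a k.+1).
Proof.
move=> kn; apply: (singular_kernel_bound kn (asum_ge0 a)).
  by move=> x; exact: continuous_ker.
move=> x x0; have r0 := x0; rewrite -enorm_gt0 in r0.
rewrite /ker enorm_sqnormV normrM normfV normrX (ger0_norm (enorm_ge0 _)).
rewrite doubleS exprS invfM mulrA ler_wpM2r//.
  by rewrite invr_ge0 exprn_ge0// ltW.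
by rewrite ler_pdivrMr//; exact: ler_linform.
Qed.

Lemma singular_kernel_dker a k i : (k.+1.*2 <= n)%N ->
  singular_kernel (dker a k.+1 i).
Proof.
move=> kn; apply: (@singular_kernel_bound _ _ _
    (asum a + 2 * k.+1%:R * asum a) _ kn).
- by rewrite addr_ge0 ?mulr_ge0.
- by move=> x; exact: continuous_dker.
move=> x x0; have r0 := x0; rewrite -enorm_gt0 in r0.
have rk : 0 <= enorm x ^- k.+1.*2 by rewrite invr_ge0 exprn_ge0// ltW.
rewrite /dker !enorm_sqnormV [leRHS]mulrDl; apply: le_trans (ler_normB _ _) _.
apply: lerD.
  by rewrite normrM [`|_^-1|]ger0_norm// ler_wpM2r.
rewrite !normrM normfV !normr_nat normrX (ger0_norm (enorm_ge0 _)).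
rewrite -!mulrA ler_wpM2l// ler_wpM2l//.
rewrite (enormV_double _ k.+1).
(* Each linear factor is paired with one [1 / |x|], which makes the quotient bounded. *)
rewrite [leLHS](_ : _ = `|x 0 i| / enorm x * (`|linform a x| / enorm x) * enorm x ^- k.+1.*2); last first.
  by ring.
rewrite ler_wpM2r// -[leRHS]mul1r ler_pM//.
- by rewrite divr_ge0// enorm_ge0.
- by rewrite divr_ge0// enorm_ge0.
- by rewrite ler_pdivrMr// mul1r ler_coord_enorm.
- by rewrite ler_pdivrMr//; exact: ler_linform.
Qed.

Lemma singular_kernel_ddker a k i : (k.+1.*2.+1 <= n)%N ->
  singular_kernel (ddker a k.+1 i).
Proof.
move=> kn; apply: (@singular_kernel_bound _ _ _
    (2 * k.+1%:R * (3 * asum a) + 4 * k.+1%:R * k.+2%:R * asum a) _ kn).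
- by rewrite addr_ge0 ?mulr_ge0.
- by move=> x; exact: continuous_ddker.
move=> x x0; have r0 := x0; rewrite -enorm_gt0 in r0.
have rk j : 0 <= enorm x ^- j by rewrite invr_ge0 exprn_ge0// ltW.
have xi : `|x 0 i| / enorm x <= 1.
  by rewrite ler_pdivrMr// mul1r ler_coord_enorm.
have xi0 : 0 <= `|x 0 i| / enorm x by rewrite divr_ge0// enorm_ge0.
have lx : `|linform a x| / enorm x <= asum a.
  by rewrite ler_pdivrMr//; exact: ler_linform.
have lx0 : 0 <= `|linform a x| / enorm x by rewrite divr_ge0// enorm_ge0.
rewrite /ddker !enorm_sqnormV [leRHS]mulrDl; apply: le_trans (ler_normD _ _) _.
apply: lerD.
  rewrite normrN !normrM normfV !normr_nat normrX (ger0_norm (enorm_ge0 _)).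
  rewrite -2![leLHS]mulrA -2![leRHS]mulrA ler_wpM2l// ler_wpM2l//.
  rewrite (enormV_double _ k.+1) (enormV_doubleS _ k.+1).
  set X := `|_ + _|; rewrite [leLHS](_ : _ =
    X / enorm x * ((enorm x)^-1 * enorm x ^- k.+1.*2)); last by ring.
  rewrite ler_wpM2r ?mulr_ge0 ?rk// ?invr_ge0 ?enorm_ge0//.
  apply: (@le_trans _ _ (2 * (`|a i| * (`|x 0 i| / enorm x)) + `|linform a x| / enorm x)).
    rewrite /X !mulrA -mulrDl ler_wpM2r// ?invr_ge0 ?enorm_ge0//.
    by apply: le_trans (ler_normD _ _) _; rewrite !normrM normr_nat.
  have : `|a i| * (`|x 0 i| / enorm x) <= asum a by rewrite -[leRHS]mulr1 ler_pM.
  by lra.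
rewrite !normrM normfV !normr_nat !normrX (ger0_norm (enorm_ge0 _)).
rewrite -!mulrA ler_wpM2l// ler_wpM2l// ler_wpM2l//.
rewrite (enormV_double _ k.+2) (enormV_double _ k.+1).
rewrite [leLHS](_ : _ = (`|x 0 i| / enorm x) ^+ 2 * (`|linform a x| / enorm x)
  * enorm x ^- k.+1.*2.+1); last by rewrite (enormV_doubleS _ k.+1); ring.
rewrite ler_wpM2r// -[leRHS]mul1r ler_pM// ?sqr_ge0//.
by rewrite expr_le1.
Qed.

End LinearKernels.

(** * The Clifford-valued kernels [x^* q^-k] *)

Section VectorKernels.
Context {R : realType} {n : nat}.
Implicit Types (f : 'rV[R]_n.+1 -> clifford R n) (i : 'I_n.+1).
Implicit Types (x : 'rV[R]_n.+1) (k : nat) (A : {set 'I_n}).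

(** The conjugate of [e i], which is also a right inverse of it by [e_econj]. *)
Definition econj i : clifford R n :=
  if unlift ord0 i is Some j then - gen j else 1.

(** For fixed [A], the coefficients of the linear form [coef A (pconj x)]; they turn each coordinate
    of [vker k] into a scalar [ker]. *)
Definition cofe A i : R := coef A (econj i).

Definition vker k x : clifford R n := sqnorm x ^- k *: pconj x.

Lemma pconj_sum x : pconj x = \sum_i x 0 i *: econj i.
Proof.
rewrite big_ord_recl /econj unlift_none /pconj -sumrN; congr (_ + _).
by apply: eq_bigr => j _; rewrite liftK scalerN.
Qed.

Lemma coefZ A c (a : clifford R n) : coef A (c *: a) = c * coef A a.
Proof. by rewrite linearZ. Qed.

Lemma coefB A (a b : clifford R n) : coef A (a - b) = coef A a - coef A b.
Proof. by rewrite linearB. Qed.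

Lemma coef_pconj A x : coef A (pconj x) = linform (cofe A) x.
Proof.
rewrite pconj_sum linear_sum; apply: eq_bigr => i _.
by rewrite [LHS]coefZ mulrC.
Qed.

Lemma coef_vker A k x : coef A (vker k x) = ker (cofe A) k x.
Proof. by rewrite /vker coefZ coef_pconj mulrC. Qed.

Lemma near_neq0 x : x != 0 -> \forall y \near x, y != 0.
Proof. by move=> x0; apply: open_nbhs_nbhs; split => //; exact: open_neq0. Qed.

(** A derivative depends only on the germ at [x], so a formula valid off the origin can be
    differentiated there. The iterated Laplacians are known only off the origin. *)
Lemma partial_near (g h : 'rV[R]_n.+1 -> R) dh i x :
  x != 0 -> (forall y, y != 0 -> g y = h y) ->
  is_derive x (delta_mx 0 i) h dh -> partial i g x = dh.
Proof.
move=> x0 gh [_ <-]; apply: near_eq_derive.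
by apply: filterS (near_neq0 x0) => y; exact: gh.
Qed.

Lemma coef_cpartial A i f x :
  coef A (cpartial i f x) = partial i (fun y => coef A (f y)) x.
Proof. by rewrite /coef ffunE. Qed.

Lemma coef_cpartial_vker f (c : R) k i x A :
  (forall y, y != 0 -> f y = c *: vker k y) -> x != 0 ->
  coef A (cpartial i f x) = c * dker (cofe A) k i x.
Proof.
move=> fE x0; rewrite coef_cpartial.
apply: (@partial_near _ (fun y => c * ker (cofe A) k y)) => // [y y0|].
  by rewrite fE// coefZ coef_vker.
refine (is_deriveZ c (is_derive_ker _ _ _ x0)).
Qed.

Lemma laplacian_vker f (c : R) k x :
  (forall y, y != 0 -> f y = c *: vker k y) -> x != 0 ->
  laplacian f x = (c * - (2 * k%:R * (n.+1%:R - 2 * k%:R))) *: vker k.+1 x.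
Proof.
move=> fE x0; apply/cliffordP => A.
rewrite coefZ coef_vker [RHS](_ : _ = c * \sum_i ddker (cofe A) k i x); last first.
  by rewrite sum_ddker// [RHS]mulrA.
rewrite linear_sum mulr_sumr; apply: eq_bigr => i _.
rewrite [LHS]coef_cpartial.
apply: (@partial_near _ (fun y => c * dker (cofe A) k i y)) => // [y y0|].
  exact: coef_cpartial_vker.
refine (is_deriveZ c (is_derive_dker _ _ _ x0)).
Qed.

Lemma e_econj i : e R i * econj i = 1 :> clifford R n.
Proof.
by rewrite /e /econj; case: unlift => [j|]; rewrite ?mulr1// mulrN gen_sqr opprK.
Qed.

(** The derivative in direction [i] is [c q^-k econj i - 2 c k x_i q^-(k+1) x^*]. Multiplied by
    [e i] and summed, the first part gives [n + 1] copies of 1 and the second produces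
    [x x^* = q]. *)
Lemma cauchyD_vker f (c : R) k x :
  (forall y, y != 0 -> f y = c *: vker k y) -> x != 0 ->
  cauchyD f x = (c * (n.+1%:R - 2 * k%:R) * sqnorm x ^- k)%:A.
Proof.
move=> fE x0; have q0 := sqnorm_neq0 x0.
have dfE i : cpartial i f x = (c * sqnorm x ^- k) *: econj i -
    (c * 2 * k%:R * sqnorm x ^- k.+1 * x 0 i) *: pconj x.
  apply/cliffordP => A; rewrite (coef_cpartial_vker _ _ fE)// coefB !coefZ.
  by rewrite coef_pconj /dker -/(cofe A i); ring.
rewrite /cauchyD.
under eq_bigr do rewrite dfE mulrBr -!scalerAr e_econj.
rewrite sumrB sumr_const card_ord.
under eq_bigr do rewrite -scalerA scalerAl.
rewrite -scaler_sumr -mulr_suml -/(paravector x) paravector_pconj -/(sqnorm x).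
rewrite -scaler_nat !scalerA -scalerBl; congr (_ *: _).
have -> : sqnorm x ^- k.+1 = (sqnorm x)^-1 * sqnorm x ^- k by rewrite exprS invfM.
by rewrite -/(sqnorm x); move: (sqnorm x ^- k) => u; field.
Qed.

End VectorKernels.

(** * Smoothness off the origin *)

Section RationalOff0.
Context {R : realType} {n : nat}.
Implicit Types (f g : 'rV[R]_n.+1 -> R) (i : 'I_n.+1) (x : 'rV[R]_n.+1).

(** A class closed under partial derivatives off 0, which reduces [class_C] to an induction on the
    order. *)
Inductive rational_off0 : ('rV[R]_n.+1 -> R) -> Prop :=
| rational_cst c : rational_off0 (cst c)
| rational_coord l : rational_off0 (fun x => x 0 l)
| rational_add f g : rational_off0 f -> rational_off0 g ->
    rational_off0 (f \+ g)
| rational_mul f g : rational_off0 f -> rational_off0 g ->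
    rational_off0 (f \* g)
| rational_sqnormV k : rational_off0 (fun x => sqnorm x ^- k).

Lemma rational_continuous f x : rational_off0 f -> x != 0 ->
  {for x, continuous f}.
Proof.
move=> rf x0; elim: rf => {f} [c|l|f g _ cf _ cg|f g _ cf _ cg|k].
- exact: cst_continuous.
- exact: coord_continuous.
- exact: continuousD.
- exact: continuousM.
- exact: continuous_sqnormV.
Qed.

Lemma rational_is_derive f i : rational_off0 f ->
  exists2 g, rational_off0 g &
    forall x, x != 0 -> is_derive x (delta_mx 0 i) f (g x).
Proof.
elim=> {f} [c|l|f g rf [df rdf dfE] rg [dg rdg dgE]
           |f g rf [df rdf dfE] rg [dg rdg dgE]|k].
- exists (cst 0); first exact: rational_cst.
  by move=> x _; exact: is_derive_cst.
- exists (cst (l == i)%:R); first exact: rational_cst.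
  by move=> x _; exact: is_derive_coord.
- exists (df \+ dg); first exact: rational_add.
  by move=> x x0; exact: is_deriveD (dfE x x0) (dgE x x0).
- exists ((f \* dg) \+ (g \* df)).
    by apply: rational_add; exact: rational_mul.
  by move=> x x0; exact: is_deriveM (dfE x x0) (dgE x x0).
- exists (cst (- (2 * k%:R)) \* (fun x => x 0 i) \* (fun x => sqnorm x ^- k.+1)).
    apply: rational_mul; last exact: rational_sqnormV.
    apply: rational_mul; [exact: rational_cst|exact: rational_coord].
  move=> x x0; refine (is_derive_eq (is_derive_sqnormV i k x0) _).
  by rewrite /= !mulNr.
Qed.

Lemma continuous_off0_eq f g x : (forall y, y != 0 -> g y = f y) -> x != 0 ->
  {for x, continuous f} -> {for x, continuous g}.
Proof.
move=> gf x0 cf; rewrite /prop_for /continuous_at gf//.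
have E : \forall y \near x, f y = g y.
  by apply: filterS (near_neq0 x0) => y /gf.
exact: cvg_trans (near_eq_cvg E) cf.
Qed.

(** [g] is only required to agree with [f] off 0, because [partial i g] is identified with a
    rational function only there; the induction needs this freedom. *)
Lemma class_C_rational k f g : rational_off0 f ->
  (forall x, x != 0 -> g x = f x) -> class_C k [set x | x != 0] g.
Proof.
elim: k f g => [|k IH] f g rf gf.
  by split=> // x x0; exact: continuous_off0_eq (rational_continuous rf x0).
split=> [x x0|i]; first exact: continuous_off0_eq (rational_continuous rf x0).
have [df rdf dfE] := rational_is_derive i rf.
have dgE x : x != 0 -> is_derive x (delta_mx 0 i) g (df x).
  move=> x0; apply: near_eq_is_derive (dfE x x0).
  by apply: filterS (near_neq0 x0) => y y0; rewrite gf.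
split=> [x /dgE[]//|]; apply: (IH df) => // x /dgE[_ <-].
by [].
Qed.

Lemma rational_ker (a : 'I_n.+1 -> R) k : rational_off0 (ker a k).
Proof.
apply: rational_mul; last exact: rational_sqnormV.
rewrite (_ : linform a = \sum_l (cst (a l) \* (fun y : 'rV[R]_n.+1 => y 0 l))).
  apply: (big_ind rational_off0); first exact: rational_cst.
    exact: rational_add.
  by move=> l _; apply: rational_mul; [exact: rational_cst|exact: rational_coord].
by apply/funext => y; rewrite fct_sumE.
Qed.

End RationalOff0.

(** * The exponential tail, [Gamma] at positive integers and the Gaussian integral *)

Section ExponentialTail.
Context {R : realType}.
Local Notation mu := (@lebesgue_measure R).
Implicit Types (t v a : R) (m : nat).

(** The Poisson weight of [m], or the Gamma density with parameter [m + 1]; it is the derivative of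
    [expR_tail m]. *)
Definition expR_term m t : R := expR (- t) * t ^+ m / m`!%:R.

(* [1 - exp (- t) * (1 + t + ... + t ^+ m / m`!)] *)
Fixpoint expR_tail m t : R :=
  if m is m'.+1 then expR_tail m' t - expR_term m t else 1 - expR (- t).

Lemma is_derive_expRN t : is_derive t (1 : R) (fun s => expR (- s)) (- expR (- t)).
Proof.
have := @is_derive1_comp R expR -%R t (expR (- t)) (- 1) _ _.
by rewrite mulrN1; exact.
Qed.

Lemma is_derive_expR_term m t : is_derive t (1 : R) (expR_term m.+1)
  (expR_term m t - expR_term m.+1 t).
Proof.
have dX : is_derive t (1 : R) (fun s => s ^+ m.+1) (m.+1%:R * t ^+ m).
  split; first exact: exprn_derivable.
  by rewrite exp_derive /GRing.scale/= mulr1.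
have := is_deriveZ (m.+1`!%:R^-1) (is_deriveM (is_derive_expRN t) dX).
rewrite (_ : _ \*: _ = expR_term m.+1); last first.
  by apply/funext => s; rewrite /expR_term !fctE/= /GRing.scale/= [LHS]mulrC.
move=> d; apply: (is_derive_eq d).
rewrite /expR_term factS natrM /GRing.scale/= exprS; field.
by rewrite pnatr_eq0 -lt0n fact_gt0 ?natr1 ?nat1r pnatr_eq0.
Qed.

(** The derivatives of the successive terms telescope, leaving only the last weight. *)
Lemma is_derive_expR_tail m t :
  is_derive t (1 : R) (expR_tail m) (expR_term m t).
Proof.
elim: m => [|m IH].
  have := is_deriveB (is_derive_cst (1 : R) t (1 : R)) (is_derive_expRN t).
  by rewrite opprK add0r /expR_term expr0 mulr1 fact0 invr1 mulr1.
refine (is_derive_eq (is_deriveB IH (is_derive_expR_term m t)) _).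
by rewrite opprB addrCA subrr addr0.
Qed.

Lemma expR_term_ge0 m t : 0 <= t -> 0 <= expR_term m t.
Proof. by move=> t0; rewrite !mulr_ge0 ?expR_ge0 ?exprn_ge0 ?invr_ge0. Qed.

Lemma continuous_expR_term m : continuous (expR_term m).
Proof.
case: m => [|m] t; last exact: is_derive1_continuous (is_derive_expR_term m t).
rewrite (_ : expR_term 0 = fun s => expR (- s)).
  exact: is_derive1_continuous (is_derive_expRN t).
by apply/funext => s; rewrite /expR_term expr0 fact0 invr1 !mulr1.
Qed.

Lemma expR_tail0 m : expR_tail m 0 = 0.
Proof.
elim: m => /= [|m ->]; first by rewrite oppr0 expR0 subrr.
by rewrite /expR_term expr0n mulr0 mul0r subrr.
Qed.

Lemma expR_tail_ge0 m t : 0 <= t -> 0 <= expR_tail m t.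
Proof.
move=> t0; rewrite -(expR_tail0 m).
apply: (@ger0_derive1_ndecry _ (expR_tail m) 0) => // [s _|s|].
- by have [] := is_derive_expR_tail m s.
- rewrite in_itv/= andbT => s0; rewrite derive1E.
  by have [_ ->] := is_derive_expR_tail m s; rewrite expR_term_ge0// ltW.
- apply: continuous_subspaceT => s.
  exact: is_derive1_continuous (is_derive_expR_tail m s).
Qed.

Lemma expR_tail_le m t : 0 <= t -> expR_tail m t <= 1 - expR (- t).
Proof.
move=> t0; elim: m => // m IH; apply: le_trans IH.
by rewrite /= gerBl expR_term_ge0.
Qed.

Lemma expR_tail_le1 m t : 0 <= t -> expR_tail m t <= 1.
Proof. by move=> /(expR_tail_le m)/le_trans; apply; rewrite gerBl expR_ge0. Qed.

(** At [t = N q], this linear bound absorbs one factor [1 / q] in the derivatives of the regularized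
    kernel. *)
Lemma expR_tail_le_id m t : 0 <= t -> expR_tail m t <= t.
Proof.
move=> /(expR_tail_le m)/le_trans; apply.
by have := expR_ge1Dx (- t); lra.
Qed.

(** It follows from [t^(m+1) / (m+1)! <= exp t]. *)
Lemma expR_term_le m t : 0 < t -> expR_term m t <= m.+1%:R / t.
Proof.
move=> t0; have := expR_ge1Dxn m (ltW t0).
have e0 := expR_gt0 t; have f0 : 0 < m`!%:R :> R by rewrite ltr0n fact_gt0.
move=> H; have {}H : t ^+ m.+1 / m.+1`!%:R <= expR t by lra.
rewrite ler_pdivlMr//.
rewrite [leLHS](_ : _ = m.+1%:R * (t ^+ m.+1 / m.+1`!%:R) / expR t).
  by rewrite ler_pdivrMr// ler_wpM2l.
rewrite /expR_term expRN factS natrM exprS; field.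
by rewrite !gt_eqF// ?nat1r ?natr1 ltr0n.
Qed.

Lemma expR_term_le1 m t : 0 <= t -> expR_term m t <= 1.
Proof.
case: m => [|m] t0.
  by rewrite /expR_term expr0 fact0 invr1 !mulr1 -expR0 ler_expR oppr_le0.
have := expR_ge1Dxn m t0 => H.
rewrite /expR_term expRN -mulrA mulrC ler_pdivrMr ?expR_gt0// mul1r.
by lra.
Qed.

(** The weights [j <= m] are at most [(j + 1) / t], and these bounds add up to at most
    [(m + 1)^2 / t]. *)
Lemma expR_tail_ge m t : 0 < t -> 1 - (m.+1 ^ 2)%:R / t <= expR_tail m t.
Proof.
move=> t0; elim: m => [|m IH] /=.
  have := expR_term_le 0 t0; rewrite /expR_term expr0 fact0 invr1 !mulr1.
  by rewrite exp1n; lra.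
have := expR_term_le m.+1 t0.
have : (m.+1 ^ 2)%:R / t + m.+2%:R / t <= (m.+2 ^ 2)%:R / t.
  rewrite -mulrDl ler_wpM2r ?invr_ge0 ?(ltW t0)// -natrD ler_nat.
  rewrite -[m.+2]addn1 sqrnD -addnA leq_add2l addnC leq_add2l.
  by rewrite muln1 mul2n -addnn leq_addr.
by lra.
Qed.

Lemma expR_tail_cvg m : expR_tail m t @[t --> +oo] --> (1 : R).
Proof.
apply/cvgrPdist_le => e0 e0_gt0; near=> t.
have t0 : 0 < t by near: t; exact: nbhs_pinfty_gt.
rewrite ger0_norm ?subr_ge0 ?expR_tail_le1 ?(ltW t0)//.
have := expR_tail_ge m t0.
have tC : (m.+1 ^ 2)%:R / e0 <= t by near: t; apply: nbhs_pinfty_ge; exact: num_real.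
have : (m.+1 ^ 2)%:R / t <= e0 by move: tC; rewrite !ler_pdivrMr// mulrC.
by lra.
Unshelve. all: by end_near. Qed.

(** The integrand has the antiderivative [m! * expR_tail m], which is 0 at 0 and tends to [m!] at
    infinity. *)
Lemma Gamma_fact m : Gamma m.+1%:R = m`!%:R :> R.
Proof.
have tE t : 0 < t -> t `^ (m.+1%:R - 1) * expR (- t) = m`!%:R * expR_term m t.
  move=> t0; rewrite -natr1 addrK powR_mulrn ?ltW// /expR_term.
  by field; rewrite gt_eqF// ltr0n fact_gt0.
have cf : continuous (fun t => m`!%:R * expR_term m t).
  move=> t; apply: (@continuousM _ _ (cst m`!%:R) (expR_term m)).
    exact: cst_continuous.
  exact: continuous_expR_term.
have dF t : is_derive t (1 : R) (fun t => m`!%:R * expR_tail m t) (m`!%:R * expR_term m t).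
  by refine (is_deriveZ (m`!%:R) (is_derive_expR_tail m t)).
rewrite /Gamma.
transitivity (\int[mu]_(t in `]0, +oo[) (m`!%:R * expR_term m t)).
  by apply: eq_Rintegral => t; rewrite inE/= in_itv/= andbT; exact: tE.
rewrite /Rintegral integral_itv_obnd_cbnd; last first.
  by refine (measurable_funTS _); apply/measurable_EFinP; exact: continuous_measurable_fun.
rewrite (@ge0_continuous_FTC2y _ _ (fun t => m`!%:R * expR_tail m t) 0 m`!%:R).
- by rewrite expR_tail0 mulr0 sube0.
- by move=> t t0; rewrite mulr_ge0// expR_term_ge0.
- exact: continuous_subspaceT.
- rewrite -[X in _ --> X]mulr1; apply: cvgM; first exact: cvg_cst.
  exact: expR_tail_cvg.
- by move=> t _; have [] := dF t.
- apply: cvg_at_right_filter; exact: is_derive1_continuous (dF 0).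
- by move=> t _; rewrite derive1E; have [] := dF t.
Qed.

Lemma measurable_expR_sqr a : measurable_fun setT (fun t => expR (- (a * t ^+ 2))).
Proof.
apply: continuous_measurable_fun => t.
apply: (@continuous_comp _ _ _ (fun t => - (a * t ^+ 2)) expR); last exact: continuous_expR.
apply: (@continuousN _ _ _ (fun t => a * t ^+ 2)).
apply: (@continuousM _ _ (cst a) (fun t => t ^+ 2)); first exact: cst_continuous.
exact: exprn_continuous.
Qed.

(** This is the normalization of the centred normal density of variance [s^2 = 1 / (2 a)]. *)
Lemma integral_gauss a : 0 < a ->
  (\int[mu]_t (expR (- (a * t ^+ 2)))%:E = (Num.sqrt (pi / a))%:E)%E.
Proof.
move=> a0; pose s : R := Num.sqrt (2 * a)^-1.
have s0 : s != 0 by rewrite gt_eqF// sqrtr_gt0 invr_gt0 mulr_gt0.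
have s2 : s ^+ 2 *+ 2 = a^-1.
  by rewrite sqr_sqrtr ?invr_ge0 ?mulr_ge0 ?ltW// -mulr_natr; field; rewrite gt_eqF.
have p0 : 0 < Num.sqrt (pi / a) by rewrite sqrtr_gt0 divr_gt0// pi_gt0.
have := integral_normal_pdf 0 s.
rewrite (_ : (fun x => _) = fun t =>
    ((Num.sqrt (pi / a))^-1%:E * (expR (- (a * t ^+ 2)))%:E)%E); last first.
  apply/funext => t; rewrite /normal_pdf (negbTE s0) -EFinM /normal_peak /normal_fun.
  congr (_^-1 * expR _)%:E; first by rewrite -mulrnAl s2 mulrC.
  by rewrite subr0 s2 invrK mulNr mulrC.
rewrite ge0_integralZl//.
- by move=> /(congr1 (fun y => ((Num.sqrt (pi / a))%:E * y)%E));
    rewrite muleA -EFinM divff ?gt_eqF// mul1e mule1.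
- by apply/measurable_EFinP; exact: measurable_expR_sqr.
Qed.

End ExponentialTail.

(** * Gaussians as an approximate identity *)

Section GaussRV.
Context {R : realType} {m : nat}.
Local Notation leb := (@lebesgue_rV R m.*2.+2).
Implicit Types (a : R) (x : 'rV[R]_m.*2.+2) (phi : 'rV[R]_m.*2.+2 -> R).

Definition gauss a x : R := expR (- (a * sqnorm x)).

Lemma gauss_ge0 a x : 0 <= gauss a x.
Proof. exact: expR_ge0. Qed.

Lemma continuous_gauss a : continuous (gauss a).
Proof.
move=> x; apply: (@continuous_comp _ _ _ (fun y => - (a * sqnorm y)) expR).
  apply: (@continuousN _ _ _ (fun y => a * sqnorm y)).
  apply: (@continuousM _ _ (cst a) sqnorm); first exact: cst_continuous.
  exact: continuous_sqnorm.
exact: continuous_expR.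
Qed.

(** The Gaussian is a product of [2m + 2] one-variable Gaussians, and the even dimension removes the
    square root. *)
Lemma integral_gauss_rV a : 0 < a ->
  (\int[leb]_x (gauss a x)%:E = ((pi / a) ^+ m.+1)%:E)%E.
Proof.
move=> a0.
transitivity (\int[leb]_x (\prod_(i < m.*2.+2) expR (- (a * x ord0 i ^+ 2)))%:E)%E.
  apply: eq_integral => x _; rewrite -expR_sum; congr (expR _)%:E.
  by rewrite sumrN -mulr_sumr /sqnorm enorm_sum_sqr.
rewrite (@ge0_integral_prod_rV _ _ (fun t => expR (- (a * t ^+ 2)))).
- rewrite integral_gauss// prodEFin; congr (_%:E).
  rewrite prodr_const card_ord -doubleS -mul2n exprM sqr_sqrtr//.
  by rewrite divr_ge0 ?pi_ge0// ltW.
- exact: measurable_expR_sqr.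
- by move=> t; exact: expR_ge0.
Qed.

Lemma integrable_gauss a : 0 < a -> leb.-integrable setT (EFin \o gauss a).
Proof.
move=> a0; apply/integrableP; split.
  by apply/measurable_EFinP; apply: continuous_measurable_rV; exact: continuous_gauss.
under eq_integral do rewrite /= ger0_norm ?gauss_ge0//.
by rewrite integral_gauss_rV// ltry.
Qed.

(** Half of the exponent pays for the factor [q]: with [y = a q / 2], [y exp (- y) <= 1]. *)
Lemma sqnorm_gauss_le a x : 0 < a ->
  sqnorm x * gauss a x <= 2 / a * gauss (a / 2) x.
Proof.
move=> a0; rewrite /gauss; set y := a / 2 * sqnorm x.
have -> : a * sqnorm x = y + y by rewrite /y; field.
have -> : sqnorm x = 2 / a * y by rewrite /y; field; rewrite gt_eqF.
rewrite opprD expRD -(mulrA (2 / a)) ler_wpM2l ?divr_ge0 ?(ltW a0)// mulrA.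
rewrite -[leRHS]mul1r ler_wpM2r ?expR_ge0//.
rewrite expRN ler_pdivrMr ?expR_gt0// mul1r.
by have := expR_ge1Dx y; lra.
Qed.

(** Near 0 this is continuity. Elsewhere some [|x_i| >= d], so [q >= d^2] and twice the bound of
    [phi] is at most [K q]. The quadratic term can be integrated against a Gaussian. *)
Lemma test_function_dist0 phi (e : R) : test_function phi -> 0 < e ->
  exists2 K : R, 0 <= K & forall x, `|phi x - phi 0| <= e + K * sqnorm x.
Proof.
move=> tphi e0; have [M M0 phiM] := test_function_bounded tphi.
have cphi : {for 0, continuous phi} by exact: test_function_continuous.
move: cphi => /cvgrPdist_lt/(_ e e0)/nbhs_ballP[d /= d0 dphi].
have K0 : 0 <= (M + M) / d ^+ 2 by rewrite divr_ge0 ?addr_ge0// sqr_ge0.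
exists ((M + M) / d ^+ 2) => // x.
have [xd|/existsNP[i xi]] := pselect (forall i, `|x 0 i| < d).
  rewrite distrC (le_trans (ltW (dphi x _)))//.
    by split=> // i j; rewrite (ord1 i) mxE /ball/= sub0r normrN; exact: xd.
  by rewrite lerDl mulr_ge0// sqr_ge0.
rewrite ler_wpDl ?(ltW e0)//; apply: le_trans (ler_normB _ _) _.
apply: (@le_trans _ _ (M + M)); first by rewrite lerD.
rewrite -mulrA ler_peMr ?addr_ge0// mulrC ler_pdivlMr ?exprn_gt0// mul1r.
rewrite lerXn2r ?nnegrE ?enorm_ge0 ?(ltW d0)//.
by apply: le_trans (ler_coord_enorm x i); rewrite leNgt; apply/negP.
Qed.

Lemma integrable_test_gauss phi (c : R) a : test_function phi -> 0 < a ->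
  leb.-integrable setT (EFin \o (fun x => phi x * (c * gauss a x))).
Proof.
move=> tphi a0; have [M M0 phiM] := test_function_bounded tphi.
apply: (@le_integrable _ _ _ _ _ _ _ (EFin \o (fun x => M * `|c| * gauss a x))) => //.
- apply/measurable_EFinP; apply: measurable_funM.
    by apply: continuous_measurable_rV; exact: test_function_continuous.
  apply: measurable_funM => //; apply: continuous_measurable_rV.
  exact: continuous_gauss.
- move=> x _ /=; rewrite lee_fin !normrM normr_id -mulrA.
  by rewrite ler_wpM2r// ?mulr_ge0// (le_trans (phiM x))// ler_norm.
- exact: (integrableZl measurableT (M * `|c|) (integrable_gauss a0)).
Qed.

(** The scaled Gaussians all have integral [pi^(m+1)], and by [test_function_dist0] the error is at
    most [e' pi^(m+1)] plus a term of order [1 / N]. *)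
Lemma gauss_approx_identity phi : test_function phi ->
  \int[leb]_x (phi x * (k.+1%:R ^+ m.+1 * gauss k.+1%:R x)) @[k --> \oo]
    --> phi 0 * pi ^+ m.+1.
Proof.
move=> tphi; have cphi := test_function_continuous tphi.
have p0 : 0 < pi ^+ m.+1 :> R by rewrite exprn_gt0// pi_gt0.
apply/cvgrPdist_le => e e0.
(* With this choice [e'] contributes [e / 2]; [k0] below makes the quadratic term contribute at most
   [e / 2] too. *)
pose e' := e / 2 / pi ^+ m.+1.
have e'0 : 0 < e' by rewrite !divr_gt0.
have [K K0 phiK] := test_function_dist0 tphi e'0.
have [k0 k0P] : exists k0 : nat, K * 2 * (pi * 2) ^+ m.+1 / (e / 2) <= k0%:R.
  by exists (Num.truncn (K * 2 * (pi * 2) ^+ m.+1 / (e / 2))).+1; exact/ltW/truncnS_gt.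
exists k0 => // k /= k0k.
set N : R := k.+1%:R.
have N0 : 0 < N by rewrite ltr0n.
have NN0 : N != 0 by rewrite gt_eqF.
have NX : 0 < N ^+ m.+1 by rewrite exprn_gt0.
pose G x := N ^+ m.+1 * gauss N x.
(* [H] is the wider Gaussian left by [sqnorm_gauss_le]; its integral does not depend on [N], while
   its coefficient [2 K / N] tends to 0. *)
pose H x := N ^+ m.+1 * gauss (N / 2) x.
have N20 : 0 < N / 2 by rewrite divr_gt0.
have iG : leb.-integrable setT (EFin \o G).
  exact: (integrableZl measurableT _ (integrable_gauss N0)).
have iH : leb.-integrable setT (EFin \o H).
  exact: (integrableZl measurableT _ (integrable_gauss N20)).
have IG : \int[leb]_x G x = pi ^+ m.+1.
  rewrite RintegralZl//; last exact: integrable_gauss.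
  rewrite /Rintegral integral_gauss_rV//= expr_div_n mulrC divfK//.
  by rewrite gt_eqF.
have IH : \int[leb]_x H x = (pi * 2) ^+ m.+1.
  rewrite RintegralZl//; last exact: integrable_gauss.
  by rewrite /Rintegral integral_gauss_rV//= -exprMn; congr (_ ^+ _); field.
have G0 x : 0 <= G x by rewrite mulr_ge0 ?gauss_ge0// ltW.
have iphiG : leb.-integrable setT (EFin \o (fun x => phi x * G x)).
  exact: integrable_test_gauss.
have ic : leb.-integrable setT (EFin \o (fun x => phi 0 * G x)).
  exact: (integrableZl measurableT (phi 0) iG).
rewrite -IG -RintegralZl// -RintegralB//.
have iB : leb.-integrable setT (EFin \o (fun x => phi 0 * G x - phi x * G x)).
  exact: (integrableB measurableT ic iphiG).
have iS : leb.-integrable setT (EFin \o (fun x => e' * G x + K * 2 / N * H x)).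
  apply: (integrableD measurableT (f := fun x => (e' * G x)%:E)
    (g := fun x => (K * 2 / N * H x)%:E)).
    exact: (integrableZl measurableT e' iG).
  exact: (integrableZl measurableT (K * 2 / N) iH).
apply: le_trans (le_normr_Rintegral _ iB) _ => //.
apply: (@le_trans _ _ (\int[leb]_x (e' * G x + K * 2 / N * H x))).
  apply: le_Rintegral => //.
  - exact: (integrable_abse iB).
  move=> x _; rewrite -mulrBl normrM (ger0_norm (G0 x)) distrC.
  apply: (@le_trans _ _ ((e' + K * sqnorm x) * G x)); first by rewrite ler_wpM2r.
  rewrite mulrDl lerD2l /G /H mulrCA [leRHS]mulrCA ler_wpM2l ?(ltW NX)//.
  rewrite -[leLHS]mulrA [leRHS](_ : _ = K * (2 / N * gauss (N / 2) x)).
    by rewrite ler_wpM2l//; exact: sqnorm_gauss_le.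
  by rewrite !mulrA.
rewrite RintegralD//; last 2 first.
- exact: (integrableZl measurableT e' iG).
- exact: (integrableZl measurableT (K * 2 / N) iH).
rewrite (@RintegralZl _ _ _ leb setT G e')// (@RintegralZl _ _ _ leb setT H)// IG IH.
have -> : e' * pi ^+ m.+1 = e / 2 by rewrite /e' divfK// gt_eqF.
rewrite [leRHS]splitr lerD2l mulrAC ler_pdivrMr// [leRHS]mulrC -ler_pdivrMr ?divr_gt0//.
rewrite (le_trans k0P)// /N ler_nat; exact: leq_trans k0k _.
Qed.

End GaussRV.

(** * The regularized Cauchy kernel *)

Section RegularizedKernel.
Context {R : realType} {m : nat}.
Local Notation leb := (@lebesgue_rV R m.*2.+2).
Implicit Types (x : 'rV[R]_m.*2.+2) (phi : 'rV[R]_m.*2.+2 -> R).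
Implicit Types (i l : 'I_m.*2.+2) (N : R).

(** Up to the factor [(omega R m)^-1], the component of the Cauchy kernel along [econj l]. *)
Definition ckernel l x : R := x 0 l * sqnorm x ^- m.+1.

Definition reg_kernel N l x : R := ckernel l x * expR_tail m (N * sqnorm x).

Definition dreg_kernel N i l x : R :=
  ((l == i)%:R * sqnorm x ^- m.+1
    - 2 * m.+1%:R * x 0 i * x 0 l * sqnorm x ^- m.+2) * expR_tail m (N * sqnorm x)
  + 2 * N * x 0 i * x 0 l * sqnorm x ^- m.+1 * expR_term m (N * sqnorm x).

Lemma is_derive_reg_kernel N i l x : x != 0 ->
  is_derive x (delta_mx 0 i) (reg_kernel N l) (dreg_kernel N i l x).
Proof.
move=> x0.
have d1 := is_deriveM (is_derive_coord x i l) (is_derive_sqnormV i m.+1 x0).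
have d2 : is_derive x (delta_mx 0 i) (fun y => expR_tail m (N * sqnorm y))
    (expR_term m (N * sqnorm x) * (N * (2 * x 0 i))).
  apply: (is_derive_comp1 (f := fun y => N * sqnorm y)).
    exact (is_deriveZ N (is_derive_sqnorm x i)).
  exact: is_derive_expR_tail.
refine (is_derive_eq (is_deriveM d1 d2) _).
by rewrite /dreg_kernel !fctE /GRing.scale/=; ring.
Qed.

Lemma dreg_kernel_sym N i l x : dreg_kernel N i l x = dreg_kernel N l i x.
Proof. by rewrite /dreg_kernel eq_sym; ring. Qed.

(** The field [x q^-(m+1)] is divergence free off 0, as [2m + 2 - 2 (m + 1) = 0]. So the terms in
    [expR_tail] cancel, and what is left is [2 N q^-m expR_term m (N q)], in which the powers of [q]
    cancel. *)
Lemma dreg_kernel_trace N x : x != 0 ->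
  \sum_i dreg_kernel N i i x = 2 / m`!%:R * (N ^+ m.+1 * gauss N x).
Proof.
move=> x0; have q0 := sqnorm_neq0 x0.
transitivity (\sum_i (sqnorm x ^- m.+1 * expR_tail m (N * sqnorm x) +
  x 0 i ^+ 2 * (2 * N * sqnorm x ^- m.+1 * expR_term m (N * sqnorm x)
   - 2 * m.+1%:R * sqnorm x ^- m.+2 * expR_tail m (N * sqnorm x)))).
  by apply: eq_bigr => i _; rewrite /dreg_kernel eqxx mulr1n; ring.
rewrite big_split/= sumr_const card_ord -mulr_suml -enorm_sum_sqr -/(sqnorm x).
have -> : sqnorm x ^- m.+2 = (sqnorm x)^-1 * sqnorm x ^- m.+1.
  by rewrite exprS invfM.
rewrite /expR_term -/(gauss N x) -[_ *+ _]mulr_natr.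
have -> : m.*2.+2%:R = 2 * m.+1%:R :> R by rewrite -natrM mul2n doubleS.
rewrite (exprMn m N (sqnorm x)).
have -> : sqnorm x ^+ m.+1 = sqnorm x * sqnorm x ^+ m by rewrite exprS.
have -> : N ^+ m.+1 = N * N ^+ m by rewrite exprS.
have qm : sqnorm x ^+ m != 0 by rewrite expf_eq0 (negbTE q0) andbF.
have mf : m`!%:R != 0 :> R by rewrite pnatr_eq0 -lt0n fact_gt0.
move: qm mf; move: (sqnorm x ^+ m) (N ^+ m) (m`!%:R) (m.+1%:R) => Q M F c Q0 F0.
by field; rewrite q0 Q0 F0.
Qed.

Lemma continuous_expR_tail_sqnorm N : continuous (fun x => expR_tail m (N * sqnorm x)).
Proof.
move=> x; apply: (@continuous_comp _ _ _ (fun y => N * sqnorm y) (expR_tail m)).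
  apply: (@continuousM _ _ (cst N) sqnorm); first exact: cst_continuous.
  exact: continuous_sqnorm.
exact: is_derive1_continuous (is_derive_expR_tail m _).
Qed.

Lemma continuous_ckernel l x : x != 0 -> {for x, continuous (ckernel l)}.
Proof.
move=> x0; apply: continuousM; first exact: coord_continuous.
exact: continuous_sqnormV.
Qed.

Lemma singular_ckernel l : singular_kernel (ckernel l).
Proof.
have -> : ckernel l = ker (fun k => (k == l)%:R) m.+1.
  apply/funext => x; rewrite /ckernel /ker /linform (bigD1 l)//= eqxx mul1r.
  by rewrite big1 ?addr0// => k /negbTE ->; rewrite mul0r.
exact: singular_kernel_ker.
Qed.

Lemma singular_reg_kernel N l : 0 <= N -> singular_kernel (reg_kernel N l).
Proof.
move=> N0; have [cf fb] := singular_ckernel l; split=> [x x0|L].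
  apply: continuousM; first exact: continuous_ckernel.
  exact: continuous_expR_tail_sqnorm.
have [C C0 fC] := fb L; exists C => // x x0 xL.
have Nq : 0 <= N * sqnorm x by rewrite mulr_ge0// sqr_ge0.
rewrite normrM (ger0_norm (expR_tail_ge0 _ Nq)); apply: le_trans (fC x x0 xL).
by rewrite ler_piMr// expR_tail_le1.
Qed.

(** Unregularized, the derivative has order [2m + 2], the full dimension. The bounds
    [expR_tail m (N q) <= N q] and [expR_term <= 1] bring the order down to [2m], with a constant
    that grows with [N]. *)
Lemma singular_dreg_kernel N i l : 0 <= N -> singular_kernel (dreg_kernel N i l).
Proof.
move=> N0; apply: (@singular_kernel_bound _ _ _
    (N + 2 * m.+1%:R * N + 2 * N) m.*2) => //.
- by rewrite !addr_ge0 ?mulr_ge0.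
- move=> x x0; have cV k := @continuous_sqnormV R _ k x x0.
  have cc k : {for x, continuous (fun y : 'rV[R]_m.*2.+2 => y 0 k)}.
    exact: coord_continuous.
  have ck c : {for x, continuous (fun _ : 'rV[R]_m.*2.+2 => c : R)}.
    exact: cst_continuous.
  have ct : {for x, continuous (fun y => expR_tail m (N * sqnorm y))}.
    exact: continuous_expR_tail_sqnorm.
  have ce : {for x, continuous (fun y : 'rV[R]_m.*2.+2 => expR_term m (N * sqnorm y))}.
    apply: (@continuous_comp _ _ _ (fun y => N * sqnorm y) (expR_term m)).
      apply: (@continuousM _ _ (cst N) sqnorm); first exact: cst_continuous.
      exact: continuous_sqnorm.
    exact: continuous_expR_term.
  exact (continuousD (continuousM (continuousB (continuousM (ck _) (cV _))
    (continuousM (continuousM (continuousM (ck _) (cc _)) (cc _)) (cV _))) ct)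
    (continuousM (continuousM (continuousM (continuousM (ck _) (cc _)) (cc _)) (cV _)) ce)).
move=> x x0; have q0 := sqnorm_gt0 x0; have r0 := x0; rewrite -enorm_gt0 in r0.
have qn0 := lt0r_neq0 q0.
rewrite -enorm_sqnormV; set Q := sqnorm x ^- m.
have Q0 : 0 <= Q by rewrite invr_ge0 exprn_ge0// ltW.
have Nq : 0 <= N * sqnorm x by rewrite mulr_ge0// ltW.
have t0 := expR_tail_ge0 m Nq; have t1 := expR_tail_le_id m Nq.
have e0 := expR_term_ge0 m Nq; have e1 := expR_term_le1 m Nq.
have xx k j : `|x 0 k| * `|x 0 j| <= sqnorm x.
  by rewrite /sqnorm expr2 ler_pM// ler_coord_enorm.
have Q1 : sqnorm x ^- m.+1 = (sqnorm x)^-1 * Q by rewrite exprS invfM.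
have Q2 : sqnorm x ^- m.+2 = (sqnorm x)^-1 * (sqnorm x)^-1 * Q.
  by rewrite exprS invfM Q1 mulrA.
rewrite /dreg_kernel Q1 Q2 mulrBl (mulrDl _ (2 * N) Q) (mulrDl N _ Q).
set T := expR_tail _ _ in t0 t1 *; set E := expR_term _ _ in e0 e1 *.
clearbody T E.
have iq : 0 <= (sqnorm x)^-1 by rewrite invr_ge0 ltW.
have h1 : `|(l == i)%:R * ((sqnorm x)^-1 * Q) * T| <= N * Q.
  rewrite !normrM (ger0_norm iq) (ger0_norm Q0) (ger0_norm t0).
  apply: (@le_trans _ _ ((sqnorm x)^-1 * Q * T)).
    by case: eqP; rewrite ?normr1 ?mul1r// normr0 !mul0r !mulr_ge0.
  rewrite mulrAC ler_wpM2r// mulrC ler_pdivrMr//.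
have h2 : `|2 * m.+1%:R * x 0 i * x 0 l * ((sqnorm x)^-1 * (sqnorm x)^-1 * Q) * T|
    <= 2 * m.+1%:R * N * Q.
  rewrite !normrM !normr_nat (ger0_norm iq) (ger0_norm Q0) (ger0_norm t0).
  rewrite [leLHS](_ : _ = 2 * m.+1%:R * (`|x 0 i| * `|x 0 l| / sqnorm x * (T / sqnorm x)) * Q); last by ring.
  rewrite ler_wpM2r// ler_wpM2l// -[leRHS]mul1r ler_pM ?mulr_ge0//.
    by rewrite ler_pdivrMr// mul1r.
  by rewrite ler_pdivrMr.
have h3 : `|2 * N * x 0 i * x 0 l * ((sqnorm x)^-1 * Q) * E| <= 2 * N * Q.
  rewrite !normrM !normr_nat (ger0_norm iq) (ger0_norm Q0) (ger0_norm e0) (ger0_norm N0).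
  rewrite [leLHS](_ : _ = 2 * N * (`|x 0 i| * `|x 0 l| / sqnorm x * E) * Q); last by ring.
  rewrite ler_wpM2r// -[leRHS]mulr1 ler_wpM2l ?mulr_ge0//.
  rewrite -[leRHS]mul1r ler_pM ?mulr_ge0//.
  by rewrite ler_pdivrMr// mul1r.
apply: le_trans (ler_normD _ _) _; apply: lerD => //.
by apply: le_trans (ler_normB _ _) _; exact: lerD h1 h2.
Qed.

End RegularizedKernel.

(** * Distributional derivatives of the Cauchy kernel by passage to the limit *)

Section CauchyKernelLimit.
Context {R : realType} {m : nat}.
Local Notation leb := (@lebesgue_rV R m.*2.+2).
Implicit Types (x : 'rV[R]_m.*2.+2) (phi : 'rV[R]_m.*2.+2 -> R).
Implicit Types (i l : 'I_m.*2.+2).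

Lemma cvg_natSMr_pinfty (q : R) : 0 < q -> k.+1%:R * q @[k --> \oo] --> +oo.
Proof.
move=> q0; apply/cvgryPge => A; near=> k; rewrite -ler_pdivrMr//.
apply: (@le_trans _ _ k%:R); last by rewrite ler_nat.
by near: k; exact: nbhs_infty_ger.
Unshelve. all: by end_near. Qed.

(** Dominated convergence: the factor [expR_tail] lies in [[0, 1]] and tends to 1 off the origin. *)
Lemma integral_reg_kernel_cvg psi l : test_function psi ->
  \int[leb]_x (psi x * reg_kernel k.+1%:R l x) @[k --> \oo] -->
  \int[leb]_x (psi x * ckernel l x).
Proof.
move=> tpsi.
have ic := integrable_test_singular (ltn0Sn _) tpsi (singular_ckernel l).
have mc : measurable_fun setT (fun x => psi x * ckernel l x).
  by apply/measurable_EFinP; exact: measurable_int ic.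
suff H : (\int[leb]_x (psi x * reg_kernel k.+1%:R l x)%:E @[k --> \oo] -->
    \int[leb]_x (psi x * ckernel l x)%:E)%E.
  by move: H; rewrite -(fineK (integrable_fin_num measurableT ic)) => /fine_cvg.
apply: (@dominated_cvg _ _ _ _ _ measurableT
    (fun k x => (psi x * reg_kernel k.+1%:R l x)%:E) _
    (fun x => `|psi x * ckernel l x|%:E)).
- move=> k; apply/measurable_EFinP; apply: measurable_funM.
    by apply: continuous_measurable_rV; exact: test_function_continuous.
  by apply: measurable_singular_kernel; exact: singular_reg_kernel.
- move=> x _; apply: cvg_EFin; first exact: nearW.
  apply: cvgM; first exact: cvg_cst.
  (* At the origin [expR_tail] stays 0, but [ckernel] is 0 there as well. *)
  rewrite /reg_kernel -[X in _ --> X]mulr1; have [->|x0] := eqVneq x 0.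
    by rewrite /ckernel mxE !mul0r; under eq_cvg do rewrite mul0r; exact: cvg_cst.
  apply: cvgM; first exact: cvg_cst.
  apply: (@cvg_comp _ _ _ (fun k => k.+1%:R * sqnorm x) (expR_tail m)); last exact: expR_tail_cvg.
  by apply: cvg_natSMr_pinfty; exact: sqnorm_gt0.
- by [].
- exact: (integrable_norm ic).
- move=> k x _; rewrite lee_fin /reg_kernel mulrA normrM ler_piMr//.
  have Nq : 0 <= k.+1%:R * sqnorm x by rewrite mulr_ge0// sqr_ge0.
  by rewrite (ger0_norm (expR_tail_ge0 _ Nq)) expR_tail_le1.
Qed.

Lemma integral_partial_reg_kernel phi (N : R) i l : test_function phi -> 0 <= N ->
  \int[leb]_x (partial i phi x * reg_kernel N l x) =
  - \int[leb]_x (phi x * dreg_kernel N i l x).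
Proof.
move=> tphi N0; apply: integration_by_parts_singular => //.
- exact: singular_reg_kernel.
- exact: singular_dreg_kernel.
- by move=> x x0; exact: is_derive_reg_kernel.
Qed.

(** Minus the value at [phi] of the distributional derivative of [ckernel l] in direction [i]. *)
Definition cauchy_pairing phi i l : R :=
  \int[leb]_x (partial i phi x * ckernel l x).

(** The symmetry of [dreg_kernel] gives the equality for every regularized kernel, and limits are
    unique. *)
Lemma cauchy_pairing_sym phi i l : test_function phi ->
  cauchy_pairing phi i l = cauchy_pairing phi l i.
Proof.
move=> tphi.
have c1 := integral_reg_kernel_cvg (l := l) (test_function_partial i tphi).
have c2 := integral_reg_kernel_cvg (l := i) (test_function_partial l tphi).
have E : (fun k => \int[leb]_x (partial i phi x * reg_kernel k.+1%:R l x)) =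
         (fun k => \int[leb]_x (partial l phi x * reg_kernel k.+1%:R i x)).
  apply/funext => k; rewrite !integral_partial_reg_kernel//; congr (- _).
  by apply: eq_Rintegral => x _; rewrite dreg_kernel_sym.
rewrite E in c1; exact: (cvg_unique _ c1 c2).
Qed.


(** For each regularized kernel the sum is minus the integral of [phi] against a multiple of a
    Gaussian; both sides have known limits. *)
Lemma cauchy_pairing_trace phi : test_function phi ->
  \sum_i cauchy_pairing phi i i = - (2 / m`!%:R * pi ^+ m.+1 * phi 0).
Proof.
move=> tphi.
have c1 : \sum_i \int[leb]_x (partial i phi x * reg_kernel k.+1%:R i x) @[k --> \oo]
    --> \sum_i cauchy_pairing phi i i.
  apply: cvg_big => [|i _]; first exact: add_continuous.
  exact: integral_reg_kernel_cvg (test_function_partial i tphi).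
have c2 : - (2 / m`!%:R * \int[leb]_x (phi x * (k.+1%:R ^+ m.+1 * gauss k.+1%:R x)))
    @[k --> \oo] --> - (2 / m`!%:R * (phi 0 * pi ^+ m.+1)).
  apply: cvgN; apply: cvgM; first exact: cvg_cst.
  exact: gauss_approx_identity.
rewrite [RHS](_ : _ = - (2 / m`!%:R * (phi 0 * pi ^+ m.+1))); last by ring.
have E : (fun k => \sum_i \int[leb]_x (partial i phi x * reg_kernel k.+1%:R i x)) =
  (fun k => - (2 / m`!%:R * \int[leb]_x (phi x * (k.+1%:R ^+ m.+1 * gauss k.+1%:R x)))).
  apply/funext => k; set N : R := k.+1%:R.
  under eq_bigr do rewrite integral_partial_reg_kernel//.
  have ik i : leb.-integrable setT (EFin \o (fun x => phi x * dreg_kernel N i i x)).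
    by apply: integrable_test_singular => //; exact: singular_dreg_kernel.
  have iG : leb.-integrable setT (EFin \o (fun x => phi x * (N ^+ m.+1 * gauss N x))).
    exact: integrable_test_gauss.
  rewrite sumrN -Rintegral_sum//; congr (- _).
  rewrite -RintegralZl// /Rintegral; congr (fine _).
  (* The trace formula is available only off the origin, hence almost everywhere. *)
  apply: ae_eq_integral => //.
  - under eq_fun do rewrite -sumEFin.
    by apply: emeasurable_sum => i; exact: measurable_int (ik i).
  - exact: measurable_int (integrableZl measurableT (2 / m`!%:R) iG).
  apply: filterS (ae_rV_neq0 m.*2.+2) => x x0 _; congr (_%:E).
  rewrite -mulr_sumr dreg_kernel_trace; first by rewrite mulrCA.
  by apply: contra (x0 ord0) => /eqP ->; rewrite mxE.
by rewrite E in c1; exact: (cvg_unique _ c1 c2).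
Qed.

End CauchyKernelLimit.

(** * Distributional Laplacians of the kernels, and Clifford sums with symmetric coefficients *)

Section DistributionalLaplacian.
Context {R : realType} {n : nat}.
Local Notation leb := (@lebesgue_rV R n.+1).
Implicit Types (x : 'rV[R]_n.+1) (phi : 'rV[R]_n.+1 -> R).
Implicit Types (a : 'I_n.+1 -> R).

Lemma kerZ (c : R) a k x : c * ker a k x = ker (fun l => c * a l) k x.
Proof.
rewrite /ker mulrA; congr (_ * _); rewrite /linform mulr_sumr.
by apply: eq_bigr => l _; rewrite mulrA.
Qed.

(** Two integrations by parts in each direction. The condition on [k] says that [ddker], of order
    [2k + 3], is still a singular kernel. *)
Lemma integral_laplacian_ker phi a k : (k.+1.*2.+1 <= n)%N -> test_function phi ->
  \sum_i \int[leb]_x (partial i (partial i phi) x * ker a k.+1 x) =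
  \int[leb]_x (phi x * (- (2 * k.+1%:R * (n.+1%:R - 2 * k.+1%:R)) * ker a k.+2 x)).
Proof.
move=> kn tphi.
have kn1 : (k.+1.*2 <= n)%N by exact: leq_trans kn.
have kn0 : (k.*2.+1 <= n)%N by exact: leq_trans kn1.
have n0 : (0 < n)%N by exact: leq_trans kn0.
have sk := singular_kernel_ker a kn0.
have sd i := singular_kernel_dker a i kn1.
have sdd i := singular_kernel_ddker a i kn.
have ibp i : \int[leb]_x (partial i (partial i phi) x * ker a k.+1 x) =
    \int[leb]_x (phi x * ddker a k.+1 i x).
  rewrite (integration_by_parts_singular n0 (test_function_partial i tphi) sk (sd i)
    (fun x => @is_derive_ker R n a k.+1 i x)).
  rewrite (integration_by_parts_singular n0 tphi (sd i) (sdd i)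
    (fun x => @is_derive_dker R n a k.+1 i x)).
  by rewrite opprK.
under eq_bigr do rewrite ibp.
rewrite -Rintegral_sum => [|i]; last exact: integrable_test_singular.
apply: eq_Rintegral => x _; rewrite -mulr_sumr; congr (_ * _).
(* At the origin both sides are 0, because the linear form and the coordinates vanish. *)
have [->|x0] := eqVneq x 0; last exact: sum_ddker.
have l0 : linform a 0 = 0 by rewrite /linform big1// => l _; rewrite mxE mulr0.
rewrite /ker l0 mul0r mulr0 big1// => i _.
by rewrite /ddker l0 mxE !(mulr0, mul0r, addr0, oppr0).
Qed.

Lemma dist_laplacianE (T : cdist R n) phi :
  dist_laplacian T phi = \sum_i T (partial i (partial i phi)).
Proof. by apply: eq_bigr => i _; rewrite /dist_partial opprK. Qed.

Lemma coef_regular_dist A (f : 'rV[R]_n.+1 -> clifford R n) phi :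
  coef A (regular_dist f phi) = \int[leb]_x (phi x * coef A (f x)).
Proof. by rewrite /coef ffunE. Qed.

(** [T] has to be known on test functions only, and these are stable under derivatives; the
    statement can therefore be iterated. *)
Lemma dist_laplacian_vker (T : cdist R n) (c : R) k phi :
  (k.+1.*2.+1 <= n)%N -> eq_dist T (regular_dist (fun x => c *: vker k.+1 x)) ->
  test_function phi ->
  dist_laplacian T phi = regular_dist
    (fun x => (c * - (2 * k.+1%:R * (n.+1%:R - 2 * k.+1%:R))) *: vker k.+2 x) phi.
Proof.
move=> kn TE tphi; rewrite dist_laplacianE; apply/cliffordP => A.
transitivity (\sum_i coef A (T (partial i (partial i phi)))).
  exact: linear_sum.
transitivity (\sum_i \int[leb]_x
    (partial i (partial i phi) x * ker (fun l => c * cofe A l) k.+1 x)).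
  apply: eq_bigr => i _; rewrite TE; last by do 2 apply: test_function_partial.
  rewrite coef_regular_dist; apply: eq_Rintegral => x _.
  by rewrite coefZ coef_vker (kerZ c).
rewrite integral_laplacian_ker// coef_regular_dist; apply: eq_Rintegral => x _.
by rewrite coefZ coef_vker -(kerZ c); congr (_ * _); rewrite [LHS]mulrCA [LHS]mulrA.
Qed.

Lemma e_econjD (i l : 'I_n.+1) : i != l ->
  e R i * econj l + e R l * econj i = 0 :> clifford R n.
Proof.
rewrite /e /econj; case: (unliftP ord0 i) => [j ->|->];
  case: (unliftP ord0 l) => [k ->|->]; rewrite ?eqxx// => il.
- have jk : j != k by apply: contraNneq il => ->.
  by rewrite !mulrN (gen_anticomm _ jk) opprK subrr.
- by rewrite mulr1 mul1r subrr.
- by rewrite mulr1 mul1r addNr.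
Qed.

(** Adding the sum to its transpose produces [e_i econj_l + e_l econj_i], which vanishes for
    [i != l] and equals 2 for [i = l]. *)
Lemma sum_sym_e_econj (J : 'I_n.+1 -> 'I_n.+1 -> R) : (forall i l, J i l = J l i) ->
  \sum_i \sum_l J i l *: (e R i * econj l) = (\sum_i J i i)%:A :> clifford R n.
Proof.
move=> Jsym; set S := LHS.
have SE : S = \sum_i \sum_l J i l *: (e R l * econj i).
  rewrite /S exchange_big; apply: eq_bigr => i _; apply: eq_bigr => l _.
  by rewrite Jsym.
have two0 : (2 : R) != 0 by rewrite pnatr_eq0.
apply: (scalerI two0); rewrite !scaler_nat [LHS]mulr2n {2}SE /S -big_split/=.
rewrite scaler_suml -sumrMnl; apply: eq_bigr => i _; rewrite -big_split/=.
rewrite (bigD1 i)//= big1 ?addr0 => [|l li]; first by rewrite e_econj mulr2n.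
by rewrite -scalerDr e_econjD 1?eq_sym// scaler0.
Qed.

End DistributionalLaplacian.

(** * The constants, and the fundamental solution itself *)

Section FundamentalSolution.
Context {R : realType} {m : nat}.
Local Notation leb := (@lebesgue_rV R m.*2.+2).
Implicit Types (x : 'rV[R]_m.*2.+2) (phi : 'rV[R]_m.*2.+2 -> R).

(** The product of [epsilon] with the factors [-4 j (m + 1 - j)], [1 <= j <= k], contributed by the
    successive Laplacians. *)
Definition laplacian_coef k : R :=
  epsilon R m * (- 4) ^+ k * k`!%:R * (m ^_ k)%:R.

Lemma laplacian_coefS k : (k <= m)%N ->
  laplacian_coef k * - (2 * k.+1%:R * (m.*2.+2%:R - 2 * k.+1%:R)) =
  laplacian_coef k.+1.
Proof.
move=> km; rewrite /laplacian_coef factS ffactnSr !natrM natrB// exprS.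
have -> : m.*2.+2%:R = 2 * m%:R + 2 :> R by rewrite -natrM mul2n -natrD addn2.
by ring.
Qed.

(** The signs and the powers of 4 cancel against [epsilon], leaving [m! / (2 pi^(m+1))]. *)
Lemma laplacian_coefm : laplacian_coef m = (omega R m)^-1.
Proof.
rewrite /laplacian_coef /epsilon /omega Gamma_fact ffactnn exprS -mul2n exprM.
have -> : (- 4 : R) = (- 1) * 2 ^+ 2 by rewrite mulN1r expr2 -natrM.
rewrite (exprMn m (-1) (2 ^+ 2)).
have mf : m`!%:R != 0 :> R by rewrite pnatr_eq0 -lt0n fact_gt0.
have pn : pi ^+ m.+1 != 0 :> R by rewrite expf_neq0// gt_eqF// pi_gt0.
have p2 : (2 ^+ 2) ^+ m != 0 :> R by rewrite !expf_neq0.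
have s2 : (-1) ^+ m * (-1) ^+ m = 1 :> R by rewrite -expr2 sqrr_sign.
move: mf pn p2 s2; move: (m`!%:R) (pi ^+ m.+1) ((2 ^+ 2) ^+ m) ((-1) ^+ m).
move=> F P Q s F0 P0 Q0 ss.
transitivity (s * s * F / (2 * P)); first by field; rewrite F0 P0 Q0.
by rewrite ss; field; rewrite F0 P0.
Qed.

Lemma N_kernelE x : N_kernel x = laplacian_coef 0 *: vker 1 x.
Proof. by rewrite /laplacian_coef expr0 fact0 ffactn0 !mulr1. Qed.

Lemma cauchy_kernelE x : cauchy_kernel x = laplacian_coef m *: vker m.+1 x.
Proof.
by rewrite laplacian_coefm /cauchy_kernel /vker enorm_sqnormV doubleS.
Qed.

Lemma iter_laplacian_N_kernel k x : (k <= m)%N -> x != 0 ->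
  iter k (@laplacian R m.*2.+1) (@N_kernel R m) x = laplacian_coef k *: vker k.+1 x.
Proof.
elim: k x => [|k IH] x km x0; first exact: N_kernelE.
rewrite iterS (@laplacian_vker _ _ _ (laplacian_coef k) k.+1)// => [|y y0].
  by rewrite laplacian_coefS// ltnW.
by apply: IH => //; exact: ltnW.
Qed.

Lemma holomorphic_N_kernel :
  @holomorphic_cliffordian R m [set x | x != 0] (@N_kernel R m).
Proof.
split; first exact: open_neq0.
- move=> A; apply: (@class_C_rational _ _ _
      (ker (fun l => laplacian_coef 0 * cofe A l) 1)).
    exact: rational_ker.
  by move=> x x0; rewrite N_kernelE coefZ coef_vker kerZ.
(* After [m] Laplacians the exponent of [q] is [m + 1], and the factor [d - 2 (m + 1)] produced by
   [cauchyD] is 0. *)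
- move=> x x0; rewrite (@cauchyD_vker _ _ _ (laplacian_coef m) m.+1)//.
    have -> : m.*2.+2%:R = 2 * m.+1%:R :> R by rewrite -natrM mul2n doubleS.
    by rewrite subrr mulr0 mul0r scale0r.
  by move=> y y0; exact: iter_laplacian_N_kernel.
Qed.

(** [N_kernel] has order 1, at most [2m + 1]; multiplying by the indicator of [K] supplies the
    bounded support that [integrable_enorm] asks for. *)
Lemma locally_integrable_N_kernel : locally_integrable_cliff (@N_kernel R m).
Proof.
move=> A K cK; have mK := compact_measurable_rV cK.
pose a l := laplacian_coef 0 * cofe A l.
have NE x : coef A (N_kernel x) = ker a 1 x.
  by rewrite N_kernelE coefZ coef_vker kerZ.
have sN : singular_kernel (ker a 1) by exact: singular_kernel_ker.
have [L L0 KL] := compact_coord_bounded cK.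
have [C C0 aC] := sN.2 L.
apply/integrable_mkcond => //.
rewrite (_ : _ \_ K = EFin \o (fun x => \1_K x * ker a 1 x)); last first.
  apply/funext => x; rewrite patchE /= indicE NE.
  by case: (x \in K); rewrite ?mul1r ?mul0r.
apply: (@integrable_enorm _ _ _ C L) => //.
- apply: measurable_funM; first exact: measurable_indic.
  exact: measurable_singular_kernel.
- move=> x x0; rewrite indicE; case: (boolP (x \in K)) => [xK|_].
    by rewrite mul1r; apply: aC => //; apply: KL; rewrite inE in xK.
  by rewrite mul0r normr0 mulr_ge0// invr_ge0 exprn_ge0// enorm_ge0.
- move=> x; rewrite indicE; case: (boolP (x \in K)) => [xK _|_].
    by apply: KL; rewrite inE in xK.
  by rewrite mul0r eqxx.
Qed.

(** The order condition of [dist_laplacian_vker] amounts to [k < m] here, so it allows exactly the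
    [m] Laplacians required. *)
Lemma iter_dist_laplacian_N_kernel k : (k <= m)%N ->
  eq_dist (iter k (@dist_laplacian R m.*2.+1) (regular_dist (@N_kernel R m)))
    (regular_dist (fun x => laplacian_coef k *: vker k.+1 x)).
Proof.
elim: k => [|k IH] km phi tphi.
  congr (regular_dist _ phi); apply/funext => x; exact: N_kernelE.
rewrite iterS (dist_laplacian_vker (c := laplacian_coef k) (k := k))//.
- by rewrite laplacian_coefS// ltnW.
- by rewrite !ltnS leq_double.
- by apply: IH; exact: ltnW.
Qed.

(** Expanding [x^*] along the [econj l] separates the scalar pairings from the Clifford factors. *)
Lemma regular_dist_vker_partial (c : R) i phi : test_function phi ->
  regular_dist (fun x => c *: vker m.+1 x) (partial i phi) =
  \sum_l (c * cauchy_pairing phi i l) *: econj l.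
Proof.
move=> tphi; have tdphi := test_function_partial i tphi.
have il l : leb.-integrable setT (EFin \o (fun x => partial i phi x * ckernel l x)).
  by apply: integrable_test_singular => //; exact: singular_ckernel.
apply/cliffordP => A; rewrite coef_regular_dist.
transitivity (\sum_l c * cofe A l * cauchy_pairing phi i l); last first.
  rewrite linear_sum; apply: eq_bigr => l _.
  by rewrite [RHS]coefZ mulrAC.
under [RHS]eq_bigr => l _ do rewrite -RintegralZl//.
rewrite -Rintegral_sum => [|l]; last first.
  exact: (integrableZl measurableT (c * cofe A l) (il l)).
apply: eq_Rintegral => x _; rewrite coefZ coef_vker (kerZ c) /ker /linform.
rewrite mulr_suml mulr_sumr; apply: eq_bigr => l _.
by rewrite /ckernel; ring.
Qed.

Lemma cauchyD_laplacian_N_kernel_dirac :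
  eq_dist
    (dist_cauchyD
      (iter m (@dist_laplacian R m.*2.+1) (regular_dist (@N_kernel R m))))
    (measure_dist (@dirac _ 'rV[R]_m.*2.+2 0 R)).
Proof.
move=> phi tphi; rewrite /measure_dist /Rintegral integral_dirac//; last first.
  apply/measurable_EFinP; apply: continuous_measurable_rV.
  exact: test_function_continuous.
rewrite diracT mul1e /=.
(* By symmetry this double sum reduces to its trace, which is [- omega * phi 0]; the coefficient
   [- omega^-1] then leaves [phi 0]. *)
transitivity (- laplacian_coef m *: \sum_i \sum_l
    cauchy_pairing phi i l *: (e R i * econj l)).
  rewrite scaler_sumr; apply: eq_bigr => i _; rewrite /dist_partial.
  rewrite iter_dist_laplacian_N_kernel//; last exact: test_function_partial.
  rewrite regular_dist_vker_partial// mulrN scaleNr; congr (- _).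
  rewrite mulr_sumr scaler_sumr; apply: eq_bigr => l _.
  by rewrite -scalerAr scalerA.
rewrite sum_sym_e_econj; last by move=> i l; exact: cauchy_pairing_sym.
rewrite cauchy_pairing_trace// scalerA laplacian_coefm /omega Gamma_fact.
congr (_ *: _).
have mf : m`!%:R != 0 :> R by rewrite pnatr_eq0 -lt0n fact_gt0.
have pn : pi ^+ m.+1 != 0 :> R by rewrite expf_neq0// gt_eqF// pi_gt0.
by field; rewrite mf pn.
Qed.

End FundamentalSolution.

Theorem mainTheorem5 (R : realType) (m : nat) :
  (forall x : 'rV[R]_m.*2.+2, x != 0 ->
     iter m (@laplacian R m.*2.+1) (@N_kernel R m) x = cauchy_kernel x) /\
  (@holomorphic_cliffordian R m [set x | x != 0] (@N_kernel R m) /\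
   (locally_integrable_cliff (@N_kernel R m) /\
    eq_dist
      (dist_cauchyD
         (iter m (@dist_laplacian R m.*2.+1) (regular_dist (@N_kernel R m))))
      (measure_dist (@dirac _ 'rV[R]_m.*2.+2 0 R)))).
Proof.
split=> [x x0|]; first by rewrite iter_laplacian_N_kernel// cauchy_kernelE.
split; first exact: holomorphic_N_kernel.
split; first exact: locally_integrable_N_kernel.
exact: cauchyD_laplacian_N_kernel_dirac.
Qed.
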